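(* On 3-dimensional de Sitter space, in the local coordinates $(q,u)$ associated with each subalgebra $\mathscr{G}_{n,m}\subset\mathfrak{so}(1,3)$ below, let $X_A$ be the indicated basis Killing vectors of $\mathscr{G}_{n,m}$ and let $\mathscr{F}=d\mathscr{A}$ be the indicated closed 2-form invariant under them ($f_1,f_2$ arbitrary smooth functions, $\mu,\mu_1,\mu_2$ arbitrary constants, $a>0$). Then the Klein--Gordon equation $\hat H\varphi=0$ in this electromagnetic field admits the first-order symmetry algebra $\hat{\mathscr{G}}_{n,m}$ with basis $\hat X_0=ie$ and the indicated symmetry operators $\hat X_A$, and the nonzero commutation relations between the basis elements are the indicated ones. 1. $\hat{\mathscr{G}}_{1,1},\hat{\mathscr{G}}_{1,2},\hat{\mathscr{G}}_{1,3}^a,\hat{\mathscr{G}}_{1,4}$: $X_1=\partial_{q^1}$; $\mathscr{F}=dq^1\wedge df_1(u^1,u^2)+f_2(u^1,u^2)\,du^1\wedge du^2$; $\hat X_1=D_1-ief_1(u^1,u^2)$. 2. $\hat{\mathscr{G}}_{2,1},\hat{\mathscr{G}}_{2,2}$: $X_1=\partial_{q^1}$, $X_2=\partial_{q^2}$; $\mathscr{F}=\mu\,dq^1\wedge dq^2+f_1(u^1)\,dq^1\wedge du^1+f_2(u^1)\,dq^2\wedge du^1$; $\hat X_1=D_1-ie\bigl(\tfrac12\mu q^2+\int f_1(u^1)du^1\bigr)$, $\hat X_2=D_2+ie\bigl(\tfrac12\mu q^1+\int f_2(u^1)du^1\bigr)$; $[\hat X_1,\hat X_2]=\mu\hat X_0$.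 3. $\hat{\mathscr{G}}_{2,3}$: $X_1=\partial_{q^1}$, $X_2=-q^1\partial_{q^1}+\partial_{q^2}$; $\mathscr{F}=e^{q^2}dq^1\wedge(f_1(u^1)\,dq^2+df_1(u^1))+f_2(u^1)\,dq^2\wedge du^1$; $\hat X_1=D_1$, $\hat X_2=-q^1D_1+D_2-ie\int f_2(u^1)du^1$; $[\hat X_1,\hat X_2]=-\hat X_1$. 4. $\hat{\mathscr{G}}_{3,1}$: $X_1=\partial_{q^1}$, $X_2=\partial_{q^2}$, $X_3=-q^1\partial_{q^1}-q^2\partial_{q^2}+\partial_{q^3}$; $\mathscr{F}=e^{q^3}(\mu_1dq^1+\mu_2dq^2)\wedge dq^3$; $\hat X_1=D_1-ie\mu_1e^{q^3}$, $\hat X_2=D_2-ie\mu_2e^{q^3}$, $\hat X_3=-q^1D_1-q^2D_2+D_3+ie\,e^{q^3}(\mu_1q^1+\mu_2q^2)$; $[\hat X_1,\hat X_2]=0$, $[\hat X_1,\hat X_3]=-\hat X_1$, $[\hat X_2,\hat X_3]=-\hat X_2$. 5. $\hat{\mathscr{G}}_{3,2}$: $X_1=\partial_{q^1}$, $X_2=\partial_{q^2}$, $X_3=-q^2\partial_{q^1}+q^1\partial_{q^2}$; $\mathscr{F}=\mu\,dq^1\wedge dq^2$; $\hat X_1=D_1-ie\mu q^2$, $\hat X_2=D_2+ie\mu q^1$, $\hat X_3=-q^2D_1+q^1D_2+\tfrac i2e\mu\bigl((q^1)^2+(q^2)^2\bigr)$; $[\hat X_1,\hat X_2]=\mu\hat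 X_0$, $[\hat X_1,\hat X_3]=\hat X_2$, $[\hat X_2,\hat X_3]=-\hat X_1$. 6. $\hat{\mathscr{G}}_{3,3}^a$: $X_1=\partial_{q^1}$, $X_2=\partial_{q^2}$, $X_3=-(aq^1+q^2)\partial_{q^1}+(q^1-aq^2)\partial_{q^2}+\partial_{q^3}$; $\mathscr{F}=e^{aq^3}(\mu_1\cos q^3+\mu_2\sin q^3)\,dq^1\wedge dq^3+e^{aq^3}(\mu_1\sin q^3-\mu_2\cos q^3)\,dq^2\wedge dq^3$; $\hat X_1=D_1+ie\,e^{aq^3}\bigl(\tfrac{\mu_2-a\mu_1}{1+a^2}\cos q^3-\tfrac{\mu_1+a\mu_2}{1+a^2}\sin q^3\bigr)$, $\hat X_2=D_2+ie\,e^{aq^3}\bigl(\tfrac{\mu_2-a\mu_1}{1+a^2}\sin q^3+\tfrac{\mu_1+a\mu_2}{1+a^2}\cos q^3\bigr)$, $\hat X_3=-(aq^1+q^2)D_1+(q^1-aq^2)D_2+D_3+ie\,e^{aq^3}(\mu_1q^1-\mu_2q^2)\cos q^3+ie\,e^{aq^3}(\mu_1q^2+\mu_2q^1)\sin q^3$; $[\hat X_1,\hat X_2]=0$, $[\hat X_1,\hat X_3]=\hat X_2-a\hat X_1$, $[\hat X_2,\hat X_3]=-\hat X_1-a\hat X_2$. 7. $\hat{\mathscr{G}}_{3,4}$: $X_1=\partial_{q^1}$, $X_2=\sin q^1\tan q^2\,\partial_{q^1}+\cos q^1\,\partial_{q^2}$, $X_3=\cos q^1\tan q^2\,\partial_{q^1}-\sin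 q^1\,\partial_{q^2}$; $\mathscr{F}=\mu\cos q^2\,dq^1\wedge dq^2$; $\hat X_1=D_1-ie\mu\sin q^2$, $\hat X_2=\sin q^1\tan q^2\,D_1+\cos q^1D_2+ie\mu\sin q^1\cos q^2$, $\hat X_3=\cos q^1\tan q^2\,D_1-\sin q^1D_2+ie\mu\cos q^1\cos q^2$; $[\hat X_1,\hat X_2]=\hat X_3$, $[\hat X_2,\hat X_3]=\hat X_1$, $[\hat X_3,\hat X_1]=\hat X_2$. 8. $\hat{\mathscr{G}}_{3,5}$: $X_1=\partial_{q^1}$, $X_2=\sinh q^1\tan q^2\,\partial_{q^1}+\cosh q^1\,\partial_{q^2}$, $X_3=\cosh q^1\tan q^2\,\partial_{q^1}+\sinh q^1\,\partial_{q^2}$; $\mathscr{F}=\mu\cos q^2\,dq^1\wedge dq^2$; $\hat X_1=D_1-ie\mu\sin q^2$, $\hat X_2=\sinh q^1\tan q^2\,D_1+\cosh q^1D_2+ie\mu\sinh q^1\cos q^2$, $\hat X_3=\cosh q^1\tan q^2\,D_1+\sinh q^1D_2+ie\mu\cosh q^1\cos q^2$; $[\hat X_1,\hat X_2]=\hat X_3$, $[\hat X_1,\hat X_3]=\hat X_2$, $[\hat X_2,\hat X_3]=\hat X_1$. 9. $\hat{\mathscr{G}}_{4,1}$: $X_1=\partial_{q^1}$, $X_2=\partial_{q^2}$, $X_3=-q^2\partial_{q^1}+q^1\partial_{q^2}$, $X_4=-q^1\partial_{q^1}-q^2\partial_{q^2}+\partial_{q^3}$; $\mathscr{F}=0$;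 $\hat X_1=D_1$, $\hat X_2=D_2$, $\hat X_3=-q^2D_1+q^1D_2$, $\hat X_4=-q^1D_1-q^2D_2+D_3$; $[\hat X_1,\hat X_2]=0$, $[\hat X_1,\hat X_3]=\hat X_2$, $[\hat X_1,\hat X_4]=-\hat X_1$, $[\hat X_2,\hat X_3]=-\hat X_1$, $[\hat X_2,\hat X_4]=-\hat X_2$.
   Context: $\mathrm{dS}_3=\{x\in\mathbb R^{1,3}:(x^0)^2-(x^1)^2-(x^2)^2-(x^3)^2=-1\}$ with metric $g$ of signature $(+,-,-)$ induced by $\mathrm{diag}(1,-1,-1,-1)$; its scalar curvature is $R=6$. $\hat H=g^{ab}D_aD_b+\zeta R+m^2$ with $m$ the mass (massive field), $e$ the charge, and $\zeta=0$ or $\zeta=(n-1)/(4n)$ with $n=3$. $D_b=\nabla_b-ie\mathscr{A}_b$, where $D_1,D_2,D_3$ are taken along the coordinates $q^1,q^2,q^3$. A symmetry operator is an operator $\hat X$ with $[\hat H,\hat X]=\hat Q\hat H$ for some operator $\hat Q$; for the massive field and first-order $\hat X=X^aD_a+ie\chi$ this means $[\hat H,\hat X]=0$. The operators are sought in the form $\hat X_A=X_A^bD_b+ie\chi_A$, where $\chi_A$ is a solution of $d\chi_A=-\mathscr{F}(X_A,\cdot)$. $\int f\,du^1$ denotes an antiderivative. All statements are local. Coordinates, given as $(x^1,x^2,x^3,x^0)$, with $\rho^2=(q^1)^2+(q^2)^2$: $\mathscr{G}_{1,1}$: $(\cos u^2,\cos u^1\sin u^2,\sin u^1\sin u^2\cosh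 q^1,-\sin u^1\sin u^2\sinh q^1)$. $\mathscr{G}_{1,2}$: $(-\cosh u^1\cos u^2\sin q^1,\cosh u^1\cos u^2\cos q^1,\cosh u^1\sin u^2,\sinh u^1)$. $\mathscr{G}_{1,3}^a$: $(-\cosh u^1\cos u^2\sin q^1,\cosh u^1\cos u^2\cos q^1,\cosh u^1\sin u^2\cosh(aq^1)-\sinh u^1\sinh(aq^1),-\cosh u^1\sin u^2\sinh(aq^1)+\sinh u^1\cosh(aq^1))$. $\mathscr{G}_{1,4}$: with $w=\cosh u^1\sin u^2-\sinh u^1$, $(q^1w,\cosh u^1\cos u^2,\cosh u^1\sin u^2-\frac12(q^1)^2w,\sinh u^1-\frac12(q^1)^2w)$. $\mathscr{G}_{2,1},\mathscr{G}_{3,2}$: $(q^1e^{-u^1},q^2e^{-u^1},\cosh u^1-\frac12e^{-u^1}\rho^2,\sinh u^1-\frac12e^{-u^1}\rho^2)$. $\mathscr{G}_{2,2}$: $(\cos u^1\cos q^1,\cos u^1\sin q^1,\sin u^1\cosh q^2,-\sin u^1\sinh q^2)$. $\mathscr{G}_{2,3}$: $(q^1e^{q^2}\cos u^1,\sin u^1,\cos u^1(\cosh q^2-\frac12(q^1)^2e^{q^2}),-\cos u^1(\sinh q^2+\frac12(q^1)^2e^{q^2}))$. $\mathscr{G}_{3,1},\mathscr{G}_{4,1}$: $(q^1e^{q^3},q^2e^{q^3},\cosh q^3-\frac12e^{q^3}\rho^2,-\sinh q^3-\frac12e^{q^3}\rho^2)$; $\mathscr{G}_{3,3}^a$: the same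 with $q^3$ replaced by $aq^3$. $\mathscr{G}_{3,4}$: $(-\cosh u^1\sin q^1\cos q^2,\cosh u^1\cos q^1\cos q^2,\cosh u^1\sin q^2,\sinh u^1)$. $\mathscr{G}_{3,5}$: $(\sin u^1\cosh q^1\cos q^2,\sin u^1\sin q^2,\cos u^1,-\sin u^1\sinh q^1\cos q^2)$.
   Formalization: Items 2, 3 fail as printed; the operators solving dχ_A=−F(X_A,·) are used. Item 2: X̂_1=D_1−ie(μq²+∫f_1du¹), X̂_2=D_2+ie(μq¹−∫f_2du¹). Item 3: X̂_1=D_1−ie e^{q²}f_1, X̂_2=−q¹D_1+D_2+ie(q¹e^{q²}f_1−∫f_2du¹). Also e≠0. *)

(* Defs.v *)
From Stdlib Require Export Reals List.
From Coquelicot Require Export Coquelicot.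
Export ListNotations.
Open Scope R_scope.

Definition pt : Type := (R * R * R)%type.

Inductive idx : Type := c1 | c2 | c3.

Definition crd (a : idx) (p : pt) : R :=
  match a with c1 => fst (fst p) | c2 => snd (fst p) | c3 => snd p end.

Definition upd (a : idx) (p : pt) (t : R) : pt :=
  match a with
  | c1 => (t, crd c2 p, crd c3 p)
  | c2 => (crd c1 p, t, crd c3 p)
  | c3 => (crd c1 p, crd c2 p, t)
  end.

Definition sum3 (f : idx -> R) : R := f c1 + f c2 + f c3.
Definition Csum3 (f : idx -> C) : C := (f c1 + f c2 + f c3)%C.

Definition pd (a : idx) (f : pt -> R) (p : pt) : R :=
  Derive (fun t => f (upd a p t)) (crd a p).

Definition Cpd (a : idx) (phi : pt -> C) (p : pt) : C :=
  (pd a (fun q => Re (phi q)) p, pd a (fun q => Im (phi q)) p).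

Fixpoint Ck (k : nat) (U : pt -> Prop) (f : pt -> R) : Prop :=
  (forall p, U p -> continuous f p) /\
  match k with
  | O => True
  | S k' =>
      (forall a p, U p -> ex_derive (fun t => f (upd a p t)) (crd a p)) /\
      (forall a, Ck k' U (pd a f))
  end.

Definition smooth (U : pt -> Prop) (f : pt -> R) : Prop := forall k, Ck k U f.

Definition Csmooth (U : pt -> Prop) (phi : pt -> C) : Prop :=
  smooth U (fun q => Re (phi q)) /\ smooth U (fun q => Im (phi q)).

Definition antiderivative_on (U : pt -> Prop) (a : idx) (G f : R -> R) : Prop :=
  forall p, U p -> is_derive G (crd a p) (f (crd a p)).

(* A vector field is given by its triple of components in the coordinates. *)
Definition vfield : Type := pt -> R * R * R.
Definition one_form : Type := idx -> pt -> R.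
Definition two_form : Type := idx -> idx -> pt -> R.

Definition cmp (X : vfield) (a : idx) (p : pt) : R := crd a (X p).

Definition dfun (f : pt -> R) : one_form := fun a p => pd a f p.
Definition dx (b : idx) : one_form := dfun (crd b).

Definition wedge (al be : one_form) : two_form :=
  fun a b p => al a p * be b p - al b p * be a p.

Definition dform (A : one_form) : two_form :=
  fun a b p => pd a (A b) p - pd b (A a) p.

(* The 1-form F(X, .). *)
Definition contract (F : two_form) (X : vfield) : one_form :=
  fun b p => sum3 (fun a => cmp X a p * F a b p).

Definition closed2 (U : pt -> Prop) (F : two_form) : Prop :=
  forall a b c p, U p ->
    pd a (F b c) p + pd b (F c a) p + pd c (F a b) p = 0.

(* The Lie derivative along X of a tensor with two lower indices. *)
Definition lie2 (X : vfield) (T : idx -> idx -> pt -> R) (a b : idx) (p : pt) : R :=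
  sum3 (fun c => cmp X c p * pd c (T a b) p
               + T c b p * pd a (cmp X c) p
               + T a c p * pd b (cmp X c) p).

Definition invariant2 (U : pt -> Prop) (X : vfield) (T : idx -> idx -> pt -> R) : Prop :=
  forall a b p, U p -> lie2 X T a b p = 0.

(* Points of R^{1,3} are listed in the order (x^1, x^2, x^3, x^0). *)
Definition R13 : Type := (R * R * R * R)%type.

Definition mink (v w : R13) : R :=
  let '(v1, v2, v3, v0) := v in
  let '(w1, w2, w3, w0) := w in
  v0 * w0 - v1 * w1 - v2 * w2 - v3 * w3.

Definition dS3 (v : R13) : Prop := mink v v = -1.

Definition tangent (x : pt -> R13) (a : idx) (p : pt) : R13 :=
  (pd a (fun q => fst (fst (fst (x q)))) p,
   pd a (fun q => snd (fst (fst (x q)))) p,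
   pd a (fun q => snd (fst (x q))) p,
   pd a (fun q => snd (x q)) p).

Definition metric (x : pt -> R13) (a b : idx) (p : pt) : R :=
  mink (tangent x a p) (tangent x b p).

Definition nxt (a : idx) : idx := match a with c1 => c2 | c2 => c3 | c3 => c1 end.

(* Cyclic indexing makes the signs of the 3 x 3 cofactors automatic. *)
Definition cofactor (g : idx -> idx -> R) (a b : idx) : R :=
  g (nxt a) (nxt b) * g (nxt (nxt a)) (nxt (nxt b))
  - g (nxt a) (nxt (nxt b)) * g (nxt (nxt a)) (nxt b).

Definition det3 (g : idx -> idx -> R) : R :=
  sum3 (fun b => g c1 b * cofactor g c1 b).

Definition gdet (x : pt -> R13) (p : pt) : R := det3 (fun a b => metric x a b p).

Definition ginv (x : pt -> R13) (a b : idx) (p : pt) : R :=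
  cofactor (fun a b => metric x a b p) b a / gdet x p.

(* Gamma^c_{ab} of the Levi-Civita connection. *)
Definition christoffel (x : pt -> R13) (c a b : idx) (p : pt) : R :=
  / 2 * sum3 (fun d => ginv x c d p *
     (pd a (metric x d b) p + pd b (metric x d a) p - pd d (metric x a b) p)).

(* U is a nonempty open set on which x is a system of local coordinates.  As dS3
   is 3-dimensional with nondegenerate metric, gdet <> 0 says that x is immersive. *)
Definition local_chart (U : pt -> Prop) (x : pt -> R13) : Prop :=
  open U /\ (exists p, U p) /\
  (forall p q, U p -> U q -> x p = x q -> p = q) /\
  (forall p, U p -> gdet x p <> 0).

Definition op : Type := (pt -> C) -> (pt -> C).

Definition op_zero : op := fun _ _ => RtoC 0.
Definition op_add (X Y : op) : op := fun phi p => (X phi p + Y phi p)%C.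
Definition op_scal (r : R) (X : op) : op := fun phi p => (RtoC r * X phi p)%C.
Definition commutator (X Y : op) : op :=
  fun phi p => (X (Y phi) p - Y (X phi) p)%C.

Definition op_eq (U : pt -> Prop) (X Y : op) : Prop :=
  forall phi, Csmooth U phi -> forall p, U p -> X phi p = Y phi p.

Definition Dcov (e : R) (A : one_form) (a : idx) : op :=
  fun phi p => (Cpd a phi p - Ci * RtoC (e * A a p) * phi p)%C.

(* D_a D_b phi: the outer D_a contains the covariant derivative of the covector D_b phi. *)
Definition Dcov2 (x : pt -> R13) (e : R) (A : one_form) (a b : idx) : op :=
  fun phi p =>
    (Cpd a (Dcov e A b phi) p
     - Csum3 (fun c => RtoC (christoffel x c a b p) * Dcov e A c phi p)
     - Ci * RtoC (e * A a p) * Dcov e A b phi p)%C.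

Definition scalar_curvature : R := 6.

Definition KG (x : pt -> R13) (zeta m e : R) (A : one_form) : op :=
  fun phi p =>
    (Csum3 (fun a => Csum3 (fun b => RtoC (ginv x a b p) * Dcov2 x e A a b phi p))
     + RtoC (zeta * scalar_curvature + m ^ 2) * phi p)%C.

Definition first_order (e : R) (A : one_form) (X : vfield) (chi : pt -> R) : op :=
  fun phi p =>
    (Csum3 (fun b => RtoC (cmp X b p) * Dcov e A b phi p)
     + Ci * RtoC (e * chi p) * phi p)%C.

Definition ie_op (e : R) : op := fun phi p => (Ci * RtoC e * phi p)%C.

(* [H, X] = Q H reduces to [H, X] = 0 for first-order X and a massive field. *)
Definition symmetry_operator (U : pt -> Prop) (H X : op) : Prop :=
  op_eq U (commutator H X) op_zero.

(* X_0 = i e, followed by the X_A = X_A^b D_b + i e chi_A for (X_A, chi_A) in gens. *)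
Definition basis_op (e : R) (A : one_form) (gens : list (vfield * (pt -> R))) (j : nat) : op :=
  nth j (ie_op e :: map (fun g => first_order e A (fst g) (snd g)) gens) op_zero.

(* The algebra is a real Lie algebra, hence the real coefficients. *)
Definition lin_indep (U : pt -> Prop) (n : nat) (X : nat -> op) : Prop :=
  forall c : nat -> R,
    op_eq U (fun phi p => sum_n (fun j => (RtoC (c j) * X j phi p)%C) n) op_zero ->
    forall j, (j <= n)%nat -> c j = 0.

(* A triple ((j, k), Z) of rels stands for [X_j, X_k] = Z; basis elements that are
   not paired in rels, in either order, commute. *)
Definition commutation_relations (U : pt -> Prop) (n : nat) (X : nat -> op)
    (rels : list (nat * nat * op)) : Prop :=
  (forall j k Z, In (j, k, Z) rels -> op_eq U (commutator (X j) (X k)) Z) /\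
  (forall j k, (j <= n)%nat -> (k <= n)%nat ->
     ~ In (j, k) (map fst rels) -> ~ In (k, j) (map fst rels) ->
     op_eq U (commutator (X j) (X k)) op_zero).

(* In the coordinates x on U the X_A are Killing vectors, F is closed and invariant
   under them, each chi_A solves d chi_A = - F(X_A, .), and for every potential A of F
   the operators X_0, X_A form a basis of a symmetry algebra with the relations rels. *)
Definition admits_symmetry_algebra (U : pt -> Prop) (x : pt -> R13) (zeta m e : R)
    (F : two_form) (gens : list (vfield * (pt -> R)))
    (rels : (nat -> op) -> list (nat * nat * op)) : Prop :=
  (forall p, U p -> dS3 (x p)) /\
  closed2 U F /\
  (forall X chi, In (X, chi) gens ->
     invariant2 U X (metric x) /\ invariant2 U X F /\
     (forall b p, U p ->
        is_derive (fun t => chi (upd b p t)) (crd b p) (- contract F X b p))) /\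
  (forall A : one_form,
     (forall a, smooth U (A a)) ->
     (forall a b p, U p -> dform A a b p = F a b p) ->
     let X := basis_op e A gens in
     let n := length gens in
     (forall j, (j <= n)%nat -> symmetry_operator U (KG x zeta m e A) (X j)) /\
     lin_indep U n X /\
     commutation_relations U n X (rels X)).

Definition chart11 : pt -> R13 := fun '(q1, u1, u2) =>
  (cos u2, cos u1 * sin u2, sin u1 * sin u2 * cosh q1, - (sin u1 * sin u2 * sinh q1)).

Definition chart12 : pt -> R13 := fun '(q1, u1, u2) =>
  (- (cosh u1 * cos u2 * sin q1), cosh u1 * cos u2 * cos q1, cosh u1 * sin u2, sinh u1).

Definition chart13 (a : R) : pt -> R13 := fun '(q1, u1, u2) =>
  (- (cosh u1 * cos u2 * sin q1),
   cosh u1 * cos u2 * cos q1,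
   cosh u1 * sin u2 * cosh (a * q1) - sinh u1 * sinh (a * q1),
   - (cosh u1 * sin u2 * sinh (a * q1)) + sinh u1 * cosh (a * q1)).

Definition chart14 : pt -> R13 := fun '(q1, u1, u2) =>
  let w := cosh u1 * sin u2 - sinh u1 in
  (q1 * w, cosh u1 * cos u2, cosh u1 * sin u2 - / 2 * q1 ^ 2 * w,
   sinh u1 - / 2 * q1 ^ 2 * w).

Definition chart21 : pt -> R13 := fun '(q1, q2, u1) =>
  let rho2 := q1 ^ 2 + q2 ^ 2 in
  (q1 * exp (- u1), q2 * exp (- u1), cosh u1 - / 2 * exp (- u1) * rho2,
   sinh u1 - / 2 * exp (- u1) * rho2).

Definition chart32 : pt -> R13 := chart21.

Definition chart22 : pt -> R13 := fun '(q1, q2, u1) =>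
  (cos u1 * cos q1, cos u1 * sin q1, sin u1 * cosh q2, - (sin u1 * sinh q2)).

Definition chart23 : pt -> R13 := fun '(q1, q2, u1) =>
  (q1 * exp q2 * cos u1,
   sin u1,
   cos u1 * (cosh q2 - / 2 * q1 ^ 2 * exp q2),
   - (cos u1 * (sinh q2 + / 2 * q1 ^ 2 * exp q2))).

Definition chart31 : pt -> R13 := fun '(q1, q2, q3) =>
  let rho2 := q1 ^ 2 + q2 ^ 2 in
  (q1 * exp q3, q2 * exp q3, cosh q3 - / 2 * exp q3 * rho2,
   - sinh q3 - / 2 * exp q3 * rho2).

Definition chart41 : pt -> R13 := chart31.

Definition chart33 (a : R) : pt -> R13 := fun '(q1, q2, q3) => chart31 (q1, q2, a * q3).

Definition chart34 : pt -> R13 := fun '(q1, q2, u1) =>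
  (- (cosh u1 * sin q1 * cos q2), cosh u1 * cos q1 * cos q2, cosh u1 * sin q2, sinh u1).

Definition chart35 : pt -> R13 := fun '(q1, q2, u1) =>
  (sin u1 * cosh q1 * cos q2, sin u1 * sin q2, cos u1, - (sin u1 * sinh q1 * cos q2)).

(* Main.v *)
(** A Killing field X with d chi = - F(X, .) gives an operator X^a D_a + ie chi whose commutator
    with D_b is (d_b X^d) D_d: the curvature term of [D_b, D_d] is cancelled by D_b chi.  Two
    such operators therefore commute to [X, Y]^a D_a + ie F(X, Y), and the commutator with the
    Klein-Gordon operator is governed by the Lie derivatives along X of g^{ab} and of
    g^{ab} Gamma^c_{ab}, which vanish because X is Killing; neither the potential nor the
    particular chart enters.  That the given fields are Killing follows to first order in the
    coordinates: along each chart x one has X(x) = L x with a constant L in so(1,3).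
    Invariance of F follows from dF = 0 and d(F(X, .)) = - dd chi = 0. *)

Require Import Defs.
From Stdlib Require Import Lra Lia FunctionalExtensionality Arith.

(** * Smooth functions on an open set *)

(** The potential is arbitrary, known only through [dform A = F] on [U], and wave functions are
    smooth only on [U]. Hence no explicit wave operator can be written down, and an identity may be
    differentiated only where it holds on an open set. Christoffel symbols are never computed in a
    chart. The Killing equation is differentiated once, and the combination of its derivatives that
    builds the Christoffel symbols gives their derivative along X. This contains second derivatives
    of X, the same ones that appear when two covariant derivatives are moved past the operator. The
    equation for chi fixes it up to a constant. A commutation relation requires F(X_j, X_k) to equal
    the corresponding combination of the chi's exactly, which pins down the constants of those
    operators that occur on a right-hand side. X_0 is treated as the operator with zero field and
    chi = 1, so that it obeys the general formulas. Linear independence is tested on the coordinate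
    functions, which see only the fields, and then on the constant 1, which sees the coefficient of
    X_0. *)

Lemma upd_crd (a : idx) (p : pt) : upd a p (crd a p) = p.
Proof. now destruct p as [[q1 q2] q3], a. Qed.

Lemma crd_upd (a : idx) (p : pt) (t : R) : crd a (upd a p t) = t.
Proof. now destruct a. Qed.

Lemma upd_upd (a : idx) (p : pt) (s t : R) : upd a (upd a p s) t = upd a p t.
Proof. now destruct a. Qed.

Lemma continuous_crd (a : idx) (p : pt) : continuous (crd a) p.
Proof.
destruct p as [[q1 q2] q3], a; cbn.
- apply (continuous_comp fst fst); [apply continuous_fst | apply continuous_fst].
- apply (continuous_comp fst snd); [apply continuous_fst | apply continuous_snd].
- apply continuous_snd.
Qed.

Lemma continuous_pair {T V W : UniformSpace} (f : T -> V) (g : T -> W) (x : T) :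
  continuous f x -> continuous g x -> continuous (fun t => (f t, g t)) x.
Proof.
intros Hf Hg. apply (continuous_comp_2 f g (fun v w => (v, w))); auto.
apply continuous_ext with (f := fun z : V * W => z); [now intros [] | apply continuous_id].
Qed.

Lemma continuous_upd (a : idx) (p : pt) (t : R) : continuous (upd a p) t.
Proof.
destruct a; repeat apply continuous_pair;
  first [apply continuous_id | apply continuous_const].
Qed.

Lemma locally_upd (P : pt -> Prop) (a : idx) (p : pt) :
  locally p P -> locally (crd a p) (fun t => P (upd a p t)).
Proof.
intros H. apply (continuous_upd a p (crd a p)). now rewrite upd_crd.
Qed.

Lemma locally_eq_on (U : pt -> Prop) (f g : pt -> R) (p : pt) :
  open U -> (forall q, U q -> f q = g q) -> U p -> locally p (fun q => f q = g q).
Proof.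
intros HU Hfg Hp. apply filter_imp with (2 := HU p Hp). exact Hfg.
Qed.

Definition has_pd (a : idx) (f : pt -> R) (p : pt) : Prop :=
  ex_derive (fun t => f (upd a p t)) (crd a p).

Lemma pd_ext (U : pt -> Prop) (f g : pt -> R) :
  open U -> (forall q, U q -> f q = g q) -> forall a p, U p -> pd a f p = pd a g p.
Proof.
intros HU Hfg a p Hp. apply Derive_ext_loc.
apply (locally_upd (fun q => f q = g q)). now apply (locally_eq_on U).
Qed.

Lemma has_pd_ext (U : pt -> Prop) (f g : pt -> R) :
  open U -> (forall q, U q -> f q = g q) -> forall a p, U p -> has_pd a f p -> has_pd a g p.
Proof.
intros HU Hfg a p Hp. apply ex_derive_ext_loc.
apply (locally_upd (fun q => f q = g q)). now apply (locally_eq_on U).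
Qed.

Lemma pd_const (a : idx) (c : R) (p : pt) : pd a (fun _ => c) p = 0.
Proof. exact (Derive_const c (crd a p)). Qed.

Lemma pd_plus (a : idx) (f g : pt -> R) (p : pt) :
  has_pd a f p -> has_pd a g p -> pd a (fun q => f q + g q) p = pd a f p + pd a g p.
Proof. exact (Derive_plus (fun t => f (upd a p t)) (fun t => g (upd a p t)) (crd a p)). Qed.

Lemma pd_opp (a : idx) (f : pt -> R) (p : pt) :
  pd a (fun q => - f q) p = - pd a f p.
Proof. exact (Derive_opp (fun t => f (upd a p t)) (crd a p)). Qed.

Lemma pd_minus (a : idx) (f g : pt -> R) (p : pt) :
  has_pd a f p -> has_pd a g p -> pd a (fun q => f q - g q) p = pd a f p - pd a g p.
Proof. exact (Derive_minus (fun t => f (upd a p t)) (fun t => g (upd a p t)) (crd a p)). Qed.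

Lemma pd_mult (a : idx) (f g : pt -> R) (p : pt) :
  has_pd a f p -> has_pd a g p ->
  pd a (fun q => f q * g q) p = pd a f p * g p + f p * pd a g p.
Proof.
intros Hf Hg. unfold pd. rewrite (Derive_mult (fun t => f (upd a p t))) by assumption.
now rewrite upd_crd.
Qed.

Lemma pd_scal (a : idx) (k : R) (f : pt -> R) (p : pt) :
  pd a (fun q => k * f q) p = k * pd a f p.
Proof. exact (Derive_scal (fun t => f (upd a p t)) k (crd a p)). Qed.

(** As [U] is open, a coordinate line through a point of [U] stays in [U] for a short time; equality
    on [U] therefore passes to the partial derivatives, and the induction goes through. *)
Lemma Ck_ext (U : pt -> Prop) (k : nat) : open U -> forall f g : pt -> R,
  (forall q, U q -> f q = g q) -> Ck k U f -> Ck k U g.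
Proof.
intros HU. induction k as [|k IH]; intros f g Hfg [Hc Hk]; split.
- intros p Hp. apply continuous_ext_loc with f; [|now apply Hc].
  now apply (locally_eq_on U).
- exact I.
- intros p Hp. apply continuous_ext_loc with f; [|now apply Hc].
  now apply (locally_eq_on U).
- destruct Hk as [He Hd]. split.
  + intros a p Hp. apply (has_pd_ext U f g); auto. now apply He.
  + intros a. apply IH with (pd a f); [|apply Hd].
    intros q Hq. now apply (pd_ext U).
Qed.

Lemma Ck_pred (U : pt -> Prop) (k : nat) : forall f, Ck (S k) U f -> Ck k U f.
Proof.
induction k as [|k IH]; intros f [Hc [He Hd]]; (split; [exact Hc|]); [exact I|].
split; [exact He|]. intros a. apply IH, Hd.
Qed.

(** [Ck] speaks of the total functions [pd a f], whereas a computed derivative [df a] agrees with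
    them only on [U]; [Ck_ext] bridges the two. *)
Lemma Ck_succ (U : pt -> Prop) (k : nat) (f : pt -> R) (df : idx -> pt -> R) :
  open U -> (forall p, U p -> continuous f p) ->
  (forall a p, U p -> is_derive (fun t => f (upd a p t)) (crd a p) (df a p)) ->
  (forall a, Ck k U (df a)) -> Ck (S k) U f.
Proof.
intros HU Hc Hd Hk. split; [exact Hc|]. split.
- intros a p Hp. exists (df a p). now apply Hd.
- intros a. apply Ck_ext with (df a); auto.
  intros q Hq. symmetry. now apply is_derive_unique, Hd.
Qed.

Lemma Ck_continuous (U : pt -> Prop) (k : nat) (f : pt -> R) (p : pt) :
  Ck k U f -> U p -> continuous f p.
Proof. destruct k; intros [Hc _]; apply Hc. Qed.

Lemma Ck_is_derive (U : pt -> Prop) (k : nat) (f : pt -> R) (a : idx) (p : pt) :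
  Ck (S k) U f -> U p -> is_derive (fun t => f (upd a p t)) (crd a p) (pd a f p).
Proof. intros [_ [He _]] Hp. now apply Derive_correct, He. Qed.

Lemma Ck_pd (U : pt -> Prop) (k : nat) (f : pt -> R) (a : idx) :
  Ck (S k) U f -> Ck k U (pd a f).
Proof. intros [_ [_ Hd]]. apply Hd. Qed.

Lemma Ck_const (U : pt -> Prop) (k : nat) (c : R) : Ck k U (fun _ => c).
Proof.
revert c; induction k as [|k IH]; intros c; split; try exact I;
  try (intros; apply continuous_const).
split; [intros; apply ex_derive_const|]. intros a.
replace (pd a (fun _ => c)) with (fun _ : pt => 0); [apply IH|].
apply functional_extensionality; intros p. symmetry. apply pd_const.
Qed.

Lemma Ck_plus (U : pt -> Prop) (k : nat) : open U -> forall f g,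
  Ck k U f -> Ck k U g -> Ck k U (fun p => f p + g p).
Proof.
intros HU. induction k as [|k IH]; intros f g Hf Hg.
- split; [|exact I]. intros p Hp.
  now apply (continuous_plus f g); apply (Ck_continuous U 0).
- apply (Ck_succ U k _ (fun a p => pd a f p + pd a g p) HU).
  + intros p Hp. now apply (continuous_plus f g); apply (Ck_continuous U (S k)).
  + intros a p Hp. now apply (is_derive_plus (fun t => f (upd a p t)));
      apply (Ck_is_derive U k).
  + intros a. now apply IH; apply Ck_pd.
Qed.

Lemma Ck_mult (U : pt -> Prop) (k : nat) : open U -> forall f g,
  Ck k U f -> Ck k U g -> Ck k U (fun p => f p * g p).
Proof.
intros HU. induction k as [|k IH]; intros f g Hf Hg.
- split; [|exact I]. intros p Hp.
  now apply (continuous_mult f g); apply (Ck_continuous U 0).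
- apply (Ck_succ U k _ (fun a p => pd a f p * g p + f p * pd a g p) HU).
  + intros p Hp. now apply (continuous_mult f g); apply (Ck_continuous U (S k)).
  + intros a p Hp.
    generalize (is_derive_mult (fun t => f (upd a p t)) (fun t => g (upd a p t))
      (crd a p) _ _ (Ck_is_derive U k f a p Hf Hp) (Ck_is_derive U k g a p Hg Hp) Rmult_comm).
    unfold plus, mult; simpl. now rewrite upd_crd.
  + intros a. apply Ck_plus; trivial; apply IH; try (now apply Ck_pd); now apply Ck_pred.
Qed.

(** By the chain rule one order is gained from the composite with [h']. For the exponential, the
    inverse and the pair sine, cosine, [h'] is expressed through the same functions, so an induction
    on the order closes. *)
Lemma Ck_comp_succ (U : pt -> Prop) (k : nat) (h h' : R -> R) (f : pt -> R) :
  open U -> (forall p, U p -> is_derive h (f p) (h' (f p))) ->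
  Ck (S k) U f -> Ck k U (fun p => h' (f p)) -> Ck (S k) U (fun p => h (f p)).
Proof.
intros HU Hh Hf Hk.
apply (Ck_succ U k _ (fun a p => h' (f p) * pd a f p) HU).
- intros p Hp. apply (continuous_comp f h); [now apply (Ck_continuous U (S k))|].
  apply (ex_derive_continuous h). exists (h' (f p)). now apply Hh.
- intros a p Hp. rewrite Rmult_comm.
  apply (is_derive_comp h (fun t => f (upd a p t))); rewrite ?upd_crd.
  + now apply Hh.
  + now apply (Ck_is_derive U k).
- intros a. apply Ck_mult; trivial. now apply Ck_pd.
Qed.

Lemma Ck_comp_0 (U : pt -> Prop) (h h' : R -> R) (f : pt -> R) :
  (forall p, U p -> is_derive h (f p) (h' (f p))) ->
  Ck 0 U f -> Ck 0 U (fun p => h (f p)).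
Proof.
intros Hh [Hc _]. split; [|exact I]. intros p Hp.
apply (continuous_comp f h); [now apply Hc|].
apply (ex_derive_continuous h). exists (h' (f p)). now apply Hh.
Qed.

Lemma Ck_exp (U : pt -> Prop) (k : nat) : open U -> forall f,
  Ck k U f -> Ck k U (fun p => exp (f p)).
Proof.
intros HU f Hf. induction k as [|k IH].
- apply (Ck_comp_0 U exp exp); trivial. intros; apply is_derive_exp.
- apply (Ck_comp_succ U k exp exp); trivial; [intros; apply is_derive_exp|].
  now apply IH, Ck_pred.
Qed.

Lemma Ck_sin_cos (U : pt -> Prop) (k : nat) : open U -> forall f, Ck k U f ->
  Ck k U (fun p => sin (f p)) /\ Ck k U (fun p => cos (f p)).
Proof.
intros HU f Hf. induction k as [|k IH]; split.
- apply (Ck_comp_0 U sin cos); trivial. intros; apply is_derive_sin.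
- apply (Ck_comp_0 U cos (fun t => - sin t)); trivial. intros; apply is_derive_cos.
- apply (Ck_comp_succ U k sin cos); trivial; [intros; apply is_derive_sin|].
  now apply IH, Ck_pred.
- apply (Ck_comp_succ U k cos (fun t => - sin t)); trivial; [intros; apply is_derive_cos|].
  apply Ck_ext with (fun p => -1 * sin (f p)); trivial; [intros; ring|].
  apply Ck_mult; trivial; [apply Ck_const|]. now apply IH, Ck_pred.
Qed.

Lemma is_derive_Rinv (t : R) : t <> 0 -> is_derive Rinv t (- (/ t * / t)).
Proof. intros Ht. auto_derive; [exact Ht|]. now field. Qed.

Lemma Ck_inv (U : pt -> Prop) (k : nat) : open U -> forall f,
  (forall p, U p -> f p <> 0) -> Ck k U f -> Ck k U (fun p => / f p).
Proof.
intros HU f H0 Hf. induction k as [|k IH].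
- apply (Ck_comp_0 U Rinv (fun t => - (/ t * / t))); trivial.
  intros p Hp; now apply is_derive_Rinv, H0.
- apply (Ck_comp_succ U k Rinv (fun t => - (/ t * / t))); trivial.
  + intros p Hp; now apply is_derive_Rinv, H0.
  + apply Ck_ext with (fun p => -1 * (/ f p * / f p)); trivial; [intros; ring|].
    apply Ck_mult; trivial; [apply Ck_const|].
    apply Ck_mult; trivial; now apply IH, Ck_pred.
Qed.

Lemma is_derive_crd (a b : idx) (p : pt) :
  is_derive (fun t => crd b (upd a p t)) (crd a p)
    (match a, b with c1, c1 | c2, c2 | c3, c3 => 1 | _, _ => 0 end).
Proof.
destruct a, b; simpl; auto_derive; trivial.
Qed.

Lemma smooth_crd (U : pt -> Prop) (b : idx) : open U -> smooth U (crd b).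
Proof.
intros HU [|k].
- split; [|exact I]. intros; apply continuous_crd.
- apply (Ck_succ U k _
    (fun a _ => match a, b with c1, c1 | c2, c2 | c3, c3 => 1 | _, _ => 0 end) HU).
  + intros; apply continuous_crd.
  + intros; apply is_derive_crd.
  + intros a; apply Ck_const.
Qed.

Lemma smooth_ext (U : pt -> Prop) (f g : pt -> R) :
  open U -> (forall q, U q -> f q = g q) -> smooth U f -> smooth U g.
Proof. intros HU Hfg Hf k. now apply Ck_ext with f. Qed.

Lemma smooth_const (U : pt -> Prop) (c : R) : smooth U (fun _ => c).
Proof. intros k. apply Ck_const. Qed.

Lemma smooth_plus (U : pt -> Prop) (f g : pt -> R) :
  open U -> smooth U f -> smooth U g -> smooth U (fun p => f p + g p).
Proof. intros HU Hf Hg k. now apply Ck_plus. Qed.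

Lemma smooth_mult (U : pt -> Prop) (f g : pt -> R) :
  open U -> smooth U f -> smooth U g -> smooth U (fun p => f p * g p).
Proof. intros HU Hf Hg k. now apply Ck_mult. Qed.

Lemma smooth_opp (U : pt -> Prop) (f : pt -> R) :
  open U -> smooth U f -> smooth U (fun p => - f p).
Proof.
intros HU Hf. apply smooth_ext with (fun p => -1 * f p); trivial; [intros; ring|].
apply smooth_mult; trivial. apply smooth_const.
Qed.

Lemma smooth_minus (U : pt -> Prop) (f g : pt -> R) :
  open U -> smooth U f -> smooth U g -> smooth U (fun p => f p - g p).
Proof. intros HU Hf Hg. apply smooth_plus; trivial. now apply smooth_opp. Qed.

Lemma smooth_pow (U : pt -> Prop) (f : pt -> R) (n : nat) :
  open U -> smooth U f -> smooth U (fun p => f p ^ n).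
Proof.
intros HU Hf. induction n as [|n IH]; simpl; [apply smooth_const|now apply smooth_mult].
Qed.

Lemma smooth_inv (U : pt -> Prop) (f : pt -> R) :
  open U -> (forall p, U p -> f p <> 0) -> smooth U f -> smooth U (fun p => / f p).
Proof. intros HU H0 Hf k. now apply Ck_inv. Qed.

Lemma smooth_exp (U : pt -> Prop) (f : pt -> R) :
  open U -> smooth U f -> smooth U (fun p => exp (f p)).
Proof. intros HU Hf k. now apply Ck_exp. Qed.

Lemma smooth_sin (U : pt -> Prop) (f : pt -> R) :
  open U -> smooth U f -> smooth U (fun p => sin (f p)).
Proof. intros HU Hf k. now apply Ck_sin_cos. Qed.

Lemma smooth_cos (U : pt -> Prop) (f : pt -> R) :
  open U -> smooth U f -> smooth U (fun p => cos (f p)).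
Proof. intros HU Hf k. now apply Ck_sin_cos. Qed.

Lemma smooth_sinh (U : pt -> Prop) (f : pt -> R) :
  open U -> smooth U f -> smooth U (fun p => sinh (f p)).
Proof.
intros HU Hf. apply smooth_mult; [trivial| |apply smooth_const].
apply smooth_minus; trivial; apply smooth_exp; trivial. now apply smooth_opp.
Qed.

Lemma smooth_cosh (U : pt -> Prop) (f : pt -> R) :
  open U -> smooth U f -> smooth U (fun p => cosh (f p)).
Proof.
intros HU Hf. apply smooth_mult; [trivial| |apply smooth_const].
apply smooth_plus; trivial; apply smooth_exp; trivial. now apply smooth_opp.
Qed.

(** [G] is known only through its derivative [g]; since [g] is smooth along [U] at every order, one
    use of the chain rule per order suffices. *)
Lemma smooth_antiderivative (U : pt -> Prop) (a : idx) (G g : R -> R) :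
  open U -> antiderivative_on U a G g -> smooth U (fun p => g (crd a p)) ->
  smooth U (fun p => G (crd a p)).
Proof.
intros HU HG Hg [|k].
- apply (Ck_comp_0 U G g); trivial. now apply smooth_crd.
- apply (Ck_comp_succ U k G g); trivial. now apply smooth_crd.
Qed.

Lemma smooth_pd (U : pt -> Prop) (a : idx) (f : pt -> R) : smooth U f -> smooth U (pd a f).
Proof. intros Hf k. apply Ck_pd, Hf. Qed.

Lemma smooth_sum3 (U : pt -> Prop) (f : idx -> pt -> R) :
  open U -> (forall a, smooth U (f a)) -> smooth U (fun p => sum3 (fun a => f a p)).
Proof. intros HU Hf. now repeat apply smooth_plus. Qed.

Lemma smooth_has_pd (U : pt -> Prop) (f : pt -> R) (a : idx) (p : pt) :
  smooth U f -> U p -> has_pd a f p.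
Proof. intros Hf. destruct (Hf 1%nat) as [_ [He _]]. apply He. Qed.

Lemma smooth_continuous (U : pt -> Prop) (f : pt -> R) (p : pt) :
  smooth U f -> U p -> continuous f p.
Proof. intros Hf. destruct (Hf 0%nat) as [Hc _]. apply Hc. Qed.

Lemma has_pd_mult (a : idx) (f g : pt -> R) (p : pt) :
  has_pd a f p -> has_pd a g p -> has_pd a (fun q => f q * g q) p.
Proof. intros Hf Hg. now apply (ex_derive_mult (fun t => f (upd a p t))). Qed.

Lemma has_pd_plus (a : idx) (f g : pt -> R) (p : pt) :
  has_pd a f p -> has_pd a g p -> has_pd a (fun q => f q + g q) p.
Proof. intros Hf Hg. now apply (ex_derive_plus (fun t => f (upd a p t))). Qed.

Lemma pd_sum3 (a : idx) (f : idx -> pt -> R) (p : pt) :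
  (forall b, has_pd a (f b) p) ->
  pd a (fun q => sum3 (fun b => f b q)) p = sum3 (fun b => pd a (f b) p).
Proof.
intros Hf. unfold sum3. rewrite 2!pd_plus; auto using has_pd_plus.
Qed.

(* Schwarz's theorem is applied to the restriction of [f] to the coordinate plane through
   [p] spanned by the directions [a] and [b]. *)
Lemma pd_comm (U : pt -> Prop) (f : pt -> R) (a b : idx) (p : pt) :
  open U -> smooth U f -> U p -> pd a (pd b f) p = pd b (pd a f) p.
Proof.
intros HU Hf Hp.
assert (Hcase : a = b \/ a <> b) by (destruct a, b; first [now left | now right]).
destruct Hcase as [<-|Hab]; [reflexivity|].
set (F := fun u v => f (upd b (upd a p u) v)).
assert (Hswap : forall u v, upd b (upd a p u) v = upd a (upd b p v) u)
  by (intros; destruct a, b; easy).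
assert (H1 : forall u v, Derive (fun z => F z v) u = pd a f (upd b (upd a p u) v)).
{ intros u v. unfold pd, F. rewrite Hswap, crd_upd. apply Derive_ext.
  intros t. now rewrite Hswap, upd_upd. }
assert (H2 : forall u v, Derive (fun z => F u z) v = pd b f (upd b (upd a p u) v)).
{ intros u v. unfold pd, F. rewrite crd_upd. apply Derive_ext.
  intros t. now rewrite upd_upd. }
assert (H12 : forall u v, Derive (fun z => Derive (fun t => F z t) v) u
                          = pd a (pd b f) (upd b (upd a p u) v)).
{ intros u v. unfold pd at 1. rewrite Hswap, crd_upd. apply Derive_ext.
  intros t. rewrite H2. now rewrite Hswap, upd_upd. }
assert (H21 : forall u v, Derive (fun z => Derive (fun t => F t z) u) v
                          = pd b (pd a f) (upd b (upd a p u) v)).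
{ intros u v. unfold pd at 1. rewrite crd_upd. apply Derive_ext.
  intros t. rewrite H1. now rewrite upd_upd. }
assert (Hpp : upd b (upd a p (crd a p)) (crd b p) = p) by now rewrite upd_crd, upd_crd.
rewrite <- Hpp, <- H12, <- H21.
assert (Hcont : forall w : R * R,
  continuous (fun z : R * R => upd b (upd a p (fst z)) (snd z)) w).
{ intros [u v]. destruct a, b; try easy; repeat apply continuous_pair;
    first [apply continuous_const | apply continuous_fst | apply continuous_snd]. }
assert (Hc2 : forall h, smooth U h ->
  continuity_2d_pt (fun u v => h (upd b (upd a p u) v)) (crd a p) (crd b p)).
{ intros h Hh. apply continuity_2d_pt_filterlim.
  apply (continuous_comp (fun z : R * R => upd b (upd a p (fst z)) (snd z)) h
           (crd a p, crd b p)); [apply Hcont|].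
  simpl. rewrite Hpp. now apply (smooth_continuous U). }
(* Schwarz's theorem asks for the first and mixed derivatives to exist near the point, which
   openness of [U] provides, and for both mixed derivatives to be continuous at it. *)
apply Schwarz.
- apply locally_2d_locally.
  assert (Hl : locally (crd a p, crd b p)
    (fun z : R * R => U (upd b (upd a p (fst z)) (snd z)))).
  { apply (Hcont (crd a p, crd b p)). simpl. rewrite Hpp. now apply HU. }
  apply filter_imp with (2 := Hl). intros [u v] Huv; simpl in *.
  set (q := upd b (upd a p u) v) in *.
  assert (Ha : forall h, smooth U h -> ex_derive (fun z => h (upd b (upd a p z) v)) u).
  { intros h Hh. assert (Hq := smooth_has_pd U h a q Hh Huv).
    unfold has_pd, q in Hq. rewrite Hswap, crd_upd in Hq.
    apply ex_derive_ext with (2 := Hq). intros t. simpl. now rewrite upd_upd, Hswap. }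
  assert (Hb : forall h, smooth U h -> ex_derive (fun z => h (upd b (upd a p u) z)) v).
  { intros h Hh. assert (Hq := smooth_has_pd U h b q Hh Huv).
    unfold has_pd, q in Hq. rewrite crd_upd in Hq.
    apply ex_derive_ext with (2 := Hq). intros t. simpl. now rewrite upd_upd. }
  repeat split.
  + now apply (Ha f).
  + now apply (Hb f).
  + apply ex_derive_ext with (fun z => pd b f (upd b (upd a p z) v)).
    * intros t. now rewrite <- H2.
    * now apply (Ha (pd b f)), smooth_pd.
  + apply ex_derive_ext with (fun z => pd a f (upd b (upd a p u) z)).
    * intros t. now rewrite <- H1.
    * now apply (Hb (pd a f)), smooth_pd.
- apply continuity_2d_pt_ext with (f := fun u v => pd a (pd b f) (upd b (upd a p u) v)).
  + intros; now rewrite H12.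
  + now apply Hc2, smooth_pd, smooth_pd.
- apply continuity_2d_pt_ext with (f := fun u v => pd b (pd a f) (upd b (upd a p u) v)).
  + intros; now rewrite H21.
  + now apply Hc2, smooth_pd, smooth_pd.
Qed.

(** * Gauge covariant derivatives and first-order operators *)

Lemma C_ext (z w : C) : Re z = Re w -> Im z = Im w -> z = w.
Proof. destruct z, w; simpl; now intros -> ->. Qed.

Lemma Csmooth_plus (U : pt -> Prop) (phi psi : pt -> C) :
  open U -> Csmooth U phi -> Csmooth U psi -> Csmooth U (fun q => phi q + psi q)%C.
Proof. intros HU [] []. split; now apply smooth_plus. Qed.

Lemma Csmooth_rmult (U : pt -> Prop) (f : pt -> R) (phi : pt -> C) :
  open U -> smooth U f -> Csmooth U phi -> Csmooth U (fun q => RtoC (f q) * phi q)%C.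
Proof.
intros HU Hf []. split.
- apply smooth_ext with (fun q => f q * Re (phi q)); trivial;
    [intros; unfold Re, Im; simpl; ring | now apply smooth_mult].
- apply smooth_ext with (fun q => f q * Im (phi q)); trivial;
    [intros; unfold Re, Im; simpl; ring | now apply smooth_mult].
Qed.

Lemma Csmooth_imult (U : pt -> Prop) (f : pt -> R) (phi : pt -> C) :
  open U -> smooth U f -> Csmooth U phi -> Csmooth U (fun q => Ci * RtoC (f q) * phi q)%C.
Proof.
intros HU Hf []. split.
- apply smooth_ext with (fun q => f q * - Im (phi q)); trivial;
    [intros; unfold Re, Im; simpl; ring | now apply smooth_mult; [..|apply smooth_opp]].
- apply smooth_ext with (fun q => f q * Re (phi q)); trivial;
    [intros; unfold Re, Im; simpl; ring | now apply smooth_mult].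
Qed.

Lemma Csmooth_Cpd (U : pt -> Prop) (a : idx) (phi : pt -> C) :
  Csmooth U phi -> Csmooth U (Cpd a phi).
Proof. intros []. split; now apply smooth_pd. Qed.

Lemma Cpd_ext (U : pt -> Prop) (phi psi : pt -> C) :
  open U -> (forall q, U q -> phi q = psi q) ->
  forall a p, U p -> Cpd a phi p = Cpd a psi p.
Proof.
intros HU H a p Hp. unfold Cpd. f_equal; apply (pd_ext U); trivial;
  intros q Hq; now rewrite H.
Qed.

Lemma Cpd_plus (U : pt -> Prop) (a : idx) (phi psi : pt -> C) (p : pt) :
  Csmooth U phi -> Csmooth U psi -> U p ->
  Cpd a (fun q => phi q + psi q)%C p = (Cpd a phi p + Cpd a psi p)%C.
Proof.
intros [] [] Hp. apply C_ext; simpl; apply pd_plus; now apply (smooth_has_pd U).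
Qed.

Lemma Cpd_rmult (U : pt -> Prop) (a : idx) (f : pt -> R) (phi : pt -> C) (p : pt) :
  smooth U f -> Csmooth U phi -> U p ->
  Cpd a (fun q => RtoC (f q) * phi q)%C p
  = (RtoC (pd a f p) * phi p + RtoC (f p) * Cpd a phi p)%C.
Proof.
intros Hf [Hr Hi] Hp.
assert (H : forall h, smooth U h -> pd a (fun q => f q * h q) p = pd a f p * h p + f p * pd a h p)
  by (intros; apply pd_mult; now apply (smooth_has_pd U)).
apply C_ext; simpl.
- transitivity (pd a (fun q => f q * Re (phi q)) p);
    [f_equal; apply functional_extensionality; intros; unfold Re, Im; simpl; ring|].
  rewrite H by trivial.
  unfold Re; ring.
- transitivity (pd a (fun q => f q * Im (phi q)) p);
    [f_equal; apply functional_extensionality; intros; unfold Re, Im; simpl; ring|].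
  rewrite H by trivial.
  unfold Im; ring.
Qed.

Lemma Cpd_imult (U : pt -> Prop) (a : idx) (f : pt -> R) (phi : pt -> C) (p : pt) :
  smooth U f -> Csmooth U phi -> U p ->
  Cpd a (fun q => Ci * RtoC (f q) * phi q)%C p
  = (Ci * (RtoC (pd a f p) * phi p + RtoC (f p) * Cpd a phi p))%C.
Proof.
intros Hf [Hr Hi] Hp.
assert (H : forall h, smooth U h -> pd a (fun q => f q * h q) p = pd a f p * h p + f p * pd a h p)
  by (intros; apply pd_mult; now apply (smooth_has_pd U)).
apply C_ext; simpl.
- transitivity (pd a (fun q => - (f q * Im (phi q))) p);
    [f_equal; apply functional_extensionality; intros; unfold Re, Im; simpl; ring|].
  rewrite pd_opp, H by trivial.
  unfold Im; ring.
- transitivity (pd a (fun q => f q * Re (phi q)) p);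
    [f_equal; apply functional_extensionality; intros; unfold Re, Im; simpl; ring|].
  rewrite H by trivial.
  unfold Re; ring.
Qed.

Lemma Cpd_comm (U : pt -> Prop) (phi : pt -> C) (a b : idx) (p : pt) :
  open U -> Csmooth U phi -> U p -> Cpd a (Cpd b phi) p = Cpd b (Cpd a phi) p.
Proof.
intros HU [Hr Hi] Hp. apply C_ext; simpl; now apply (pd_comm U).
Qed.

Section Gauge.

Variables (U : pt -> Prop) (e : R) (A : one_form).
Hypotheses (HU : open U) (HA : forall a, smooth U (A a)).

Let D := Dcov e A.

(** The subtraction is turned into a sum whose second term has the shape [Ci * RtoC (f q) * phi q],
    to which [Csmooth_imult] and [Cpd_imult] apply. *)
Lemma Dcov_def (a : idx) (phi : pt -> C) :
  D a phi = (fun q => Cpd a phi q + Ci * RtoC (- e * A a q) * phi q)%C.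
Proof.
apply functional_extensionality; intros q. unfold D, Dcov.
apply C_ext; simpl; ring.
Qed.

Lemma smooth_scaled_potential (a : idx) : smooth U (fun q => - e * A a q).
Proof. apply smooth_mult; trivial. apply smooth_const. Qed.

Lemma Csmooth_Dcov (a : idx) (phi : pt -> C) : Csmooth U phi -> Csmooth U (D a phi).
Proof.
intros H. rewrite Dcov_def. apply Csmooth_plus; trivial; [now apply Csmooth_Cpd|].
apply Csmooth_imult; trivial. apply smooth_scaled_potential.
Qed.

Lemma Dcov_ext (phi psi : pt -> C) : (forall q, U q -> phi q = psi q) ->
  forall a p, U p -> D a phi p = D a psi p.
Proof.
intros H a p Hp. unfold D, Dcov. now rewrite H, (Cpd_ext U phi psi).
Qed.

Lemma Dcov_plus (a : idx) (phi psi : pt -> C) (p : pt) :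
  Csmooth U phi -> Csmooth U psi -> U p ->
  D a (fun q => phi q + psi q)%C p = (D a phi p + D a psi p)%C.
Proof.
intros H1 H2 Hp. unfold D, Dcov. rewrite (Cpd_plus U) by trivial. ring.
Qed.

Lemma Dcov_rmult (a : idx) (f : pt -> R) (phi : pt -> C) (p : pt) :
  smooth U f -> Csmooth U phi -> U p ->
  D a (fun q => RtoC (f q) * phi q)%C p
  = (RtoC (pd a f p) * phi p + RtoC (f p) * D a phi p)%C.
Proof.
intros H1 H2 Hp. unfold D, Dcov. rewrite (Cpd_rmult U) by trivial. ring.
Qed.

Lemma Dcov_imult (a : idx) (f : pt -> R) (phi : pt -> C) (p : pt) :
  smooth U f -> Csmooth U phi -> U p ->
  D a (fun q => Ci * RtoC (f q) * phi q)%C p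
  = (Ci * (RtoC (pd a f p) * phi p + RtoC (f p) * D a phi p))%C.
Proof.
intros H1 H2 Hp. unfold D, Dcov. rewrite (Cpd_imult U) by trivial. ring.
Qed.

Lemma Csmooth_sum3 (phi : idx -> pt -> C) :
  (forall b, Csmooth U (phi b)) -> Csmooth U (fun q => Csum3 (fun b => phi b q)).
Proof. intros H. now repeat apply Csmooth_plus. Qed.

Lemma Dcov_sum3 (a : idx) (phi : idx -> pt -> C) (p : pt) :
  (forall b, Csmooth U (phi b)) -> U p ->
  D a (fun q => Csum3 (fun b => phi b q)) p = Csum3 (fun b => D a (phi b) p).
Proof.
intros H Hp. unfold Csum3.
rewrite !Dcov_plus; auto using Csmooth_plus.
Qed.

(** The second partial derivatives, the terms of first order in the derivatives of [phi] and the
    term quadratic in the potential are all symmetric in [a] and [b]; only the derivatives of the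
    potential survive. *)
Lemma Dcov_comm (a b : idx) (phi : pt -> C) (p : pt) :
  Csmooth U phi -> U p ->
  D a (D b phi) p = (D b (D a phi) p - Ci * RtoC (e * dform A a b p) * phi p)%C.
Proof.
intros H Hp.
assert (Hab : forall a b, D a (D b phi) p
  = (Cpd a (Cpd b phi) p
     + Ci * (RtoC (- e * pd a (A b) p) * phi p + RtoC (- e * A b p) * Cpd a phi p)
     - Ci * RtoC (e * A a p) * D b phi p)%C).
{ intros a' b'. unfold D at 1. unfold Dcov. rewrite (Dcov_def b') at 1.
  assert (Hs := smooth_scaled_potential b').
  rewrite (Cpd_plus U), (Cpd_imult U), pd_scal;
    auto using Csmooth_Cpd, Csmooth_imult. }
rewrite !Hab, (Cpd_comm U phi a b) by trivial.
unfold D, Dcov, dform. apply C_ext; simpl; ring.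
Qed.

Lemma Csmooth_first_order (X : vfield) (chi : pt -> R) (phi : pt -> C) :
  (forall a, smooth U (cmp X a)) -> smooth U chi -> Csmooth U phi ->
  Csmooth U (first_order e A X chi phi).
Proof.
intros HX Hchi Hphi. unfold first_order. apply Csmooth_plus; trivial.
- apply Csmooth_sum3. intros b. apply Csmooth_rmult; trivial. now apply Csmooth_Dcov.
- apply Csmooth_imult; trivial. apply smooth_mult; trivial. apply smooth_const.
Qed.

(* The curvature term coming from [D_b, D_d] is cancelled by [D_b chi]; this is what the
   equation d chi = - F(X, .) is for. *)
Lemma Dcov_first_order (X : vfield) (chi : pt -> R) (F : two_form) (b : idx)
    (phi : pt -> C) (p : pt) :
  (forall a, smooth U (cmp X a)) -> smooth U chi ->
  (forall c q, U q -> pd c chi q = - contract F X c q) ->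
  (forall c d q, U q -> dform A c d q = F c d q) ->
  Csmooth U phi -> U p ->
  D b (first_order e A X chi phi) p
  = (first_order e A X chi (D b phi) p
     + Csum3 (fun d => RtoC (pd b (cmp X d) p) * D d phi p))%C.
Proof.
intros HX Hchi Hd HF Hphi Hp. unfold first_order. fold D.
assert (HDphi := fun d => Csmooth_Dcov d phi Hphi).
assert (Hs : smooth U (fun q => e * chi q)) by (apply smooth_mult; trivial; apply smooth_const).
rewrite Dcov_plus, Dcov_sum3, Dcov_imult;
  auto using Csmooth_rmult, Csmooth_imult, Csmooth_sum3.
rewrite pd_scal, Hd by trivial.
unfold Csum3. rewrite !Dcov_rmult by auto.
rewrite (Dcov_comm b c1), (Dcov_comm b c2), (Dcov_comm b c3) by trivial.
(* The commutator of [D b] and [D d] carries F with indices b, d, while [contract] sums over the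
   first index of F; the sign of this exchange is what makes the two terms cancel. *)
assert (Hanti : forall c d, dform A c d p = - F d c p).
{ intros c d. rewrite <- HF by trivial. unfold dform; ring. }
rewrite !Hanti. unfold contract, sum3.
apply C_ext; simpl; ring.
Qed.

Lemma first_order_plus (X : vfield) (chi : pt -> R) (phi psi : pt -> C) (p : pt) :
  Csmooth U phi -> Csmooth U psi -> U p ->
  first_order e A X chi (fun q => phi q + psi q)%C p
  = (first_order e A X chi phi p + first_order e A X chi psi p)%C.
Proof.
intros H1 H2 Hp. unfold first_order, Csum3. fold D.
rewrite !Dcov_plus by trivial. ring.
Qed.

Lemma first_order_rmult (X : vfield) (chi f : pt -> R) (phi : pt -> C) (p : pt) :
  smooth U f -> Csmooth U phi -> U p ->
  first_order e A X chi (fun q => RtoC (f q) * phi q)%C p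
  = (RtoC (sum3 (fun a => (cmp X a p * pd a f p)%R)) * phi p
     + RtoC (f p) * first_order e A X chi phi p)%C.
Proof.
intros H1 H2 Hp. unfold first_order, Csum3, sum3. fold D.
rewrite !Dcov_rmult by trivial. rewrite !RtoC_plus, !RtoC_mult. ring.
Qed.

Lemma first_order_sum3 (X : vfield) (chi : pt -> R) (phi : idx -> pt -> C) (p : pt) :
  (forall b, Csmooth U (phi b)) -> U p ->
  first_order e A X chi (fun q => Csum3 (fun b => phi b q)) p
  = Csum3 (fun b => first_order e A X chi (phi b) p).
Proof.
intros H Hp. unfold Csum3. rewrite !first_order_plus; auto using Csmooth_plus.
Qed.

End Gauge.

Definition lie_bracket (X Y : vfield) (a : idx) (p : pt) : R :=
  sum3 (fun b => cmp X b p * pd b (cmp Y a) p - cmp Y b p * pd b (cmp X a) p).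

Definition contract2 (F : two_form) (X Y : vfield) (p : pt) : R :=
  sum3 (fun b => contract F X b p * cmp Y b p).

(** In one order the operator of X differentiates the coefficients of Y by the Leibniz rule ([H1]);
    in the other it is moved past [D b] ([H2]), where the equation for [chi] removes the curvature.
    The terms with [XX (D b phi)] and [XX phi] then cancel. What is left is the Lie bracket and
    X(eta), which the equation for [eta] turns into - F(Y, X) = F(X, Y). *)
Lemma commutator_first_order (U : pt -> Prop) (e : R) (A : one_form) (F : two_form)
    (X Y V : vfield) (chi eta psi : pt -> R) (phi : pt -> C) (p : pt) :
  open U -> (forall a, smooth U (A a)) ->
  (forall a b q, U q -> dform A a b q = F a b q) ->
  (forall a, smooth U (cmp X a)) -> smooth U chi ->
  (forall c q, U q -> pd c chi q = - contract F X c q) ->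
  (forall a, smooth U (cmp Y a)) -> smooth U eta ->
  (forall c q, U q -> pd c eta q = - contract F Y c q) ->
  Csmooth U phi -> U p ->
  (forall a, lie_bracket X Y a p = cmp V a p) -> contract2 F X Y p = psi p ->
  commutator (first_order e A X chi) (first_order e A Y eta) phi p
  = first_order e A V psi phi p.
Proof.
intros HU HA HF HX Hchi Hdchi HY Heta Hdeta Hphi Hp HV Hpsi.
set (XX := first_order e A X chi).
assert (HD := fun a => Csmooth_Dcov U e A HU HA a phi Hphi).
assert (H1 : XX (first_order e A Y eta phi) p
  = (Csum3 (fun b => RtoC (sum3 (fun a => (cmp X a p * pd a (cmp Y b) p)%R)) * Dcov e A b phi p
        + RtoC (cmp Y b p) * XX (Dcov e A b phi) p)
     + Ci * (RtoC (e * sum3 (fun a => (cmp X a p * pd a eta p)%R)) * phi p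
     + RtoC (e * eta p) * XX phi p))%C).
{ unfold first_order at 1. unfold XX.
  assert (He : smooth U (fun q => e * eta q)) by (apply smooth_mult; trivial; apply smooth_const).
  rewrite (first_order_plus U), (first_order_sum3 U);
    auto using Csmooth_sum3, Csmooth_rmult, Csmooth_imult.
  unfold Csum3. rewrite !(first_order_rmult U) by auto.
  f_equal. unfold first_order at 1. unfold Csum3.
  rewrite !(Dcov_imult U) by auto. rewrite !pd_scal.
  unfold first_order, Csum3, sum3.
  rewrite !RtoC_mult, !RtoC_plus, !RtoC_mult. ring. }
assert (H2 : first_order e A Y eta (XX phi) p
  = (Csum3 (fun b => RtoC (cmp Y b p) * (XX (Dcov e A b phi) p
        + Csum3 (fun d => RtoC (pd b (cmp X d) p) * Dcov e A d phi p)))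
     + Ci * RtoC (e * eta p) * XX phi p)%C).
{ unfold first_order at 1. unfold Csum3 at 1, XX.
  now rewrite !(fun b => Dcov_first_order U e A HU HA X chi F b phi p) by trivial. }
unfold commutator. fold XX. rewrite H1, H2.
unfold first_order, Csum3. rewrite <- !HV, <- Hpsi. unfold lie_bracket, contract2, sum3.
rewrite !Hdeta by trivial.
assert (Hanti : forall c d, F c d p = - F d c p).
{ intros c d. rewrite <- !HF by trivial. unfold dform; ring. }
assert (Hdiag : forall c, F c c p = 0).
{ intros c. generalize (Hanti c c). lra. }
unfold contract, sum3.
rewrite !Hdiag, (Hanti c2 c1), (Hanti c3 c1), (Hanti c3 c2).
apply C_ext; unfold Re, Im; simpl; ring.
Qed.

(** * Killing vector fields and the Klein-Gordon operator *)

Definition kron (a b : idx) : R :=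
  match a, b with c1, c1 | c2, c2 | c3, c3 => 1 | _, _ => 0 end.

Lemma sum3_kron_r (h : idx -> R) (a : idx) : sum3 (fun b => h b * kron b a) = h a.
Proof. destruct a; unfold sum3; simpl; ring. Qed.

Lemma sum3_kron_l (h : idx -> R) (a : idx) : sum3 (fun b => kron a b * h b) = h a.
Proof. destruct a; unfold sum3; simpl; ring. Qed.

Lemma sum3_ext (f g : idx -> R) : (forall a, f a = g a) -> sum3 f = sum3 g.
Proof. intros H. unfold sum3. now rewrite !H. Qed.

(** Laplace expansion along column [a]: for [a] different from [b] the sum is a determinant with a
    repeated column. The mirror statement for rows follows. *)
Lemma cofactor_inverse_l (g : idx -> idx -> R) (a b : idx) : det3 g <> 0 ->
  sum3 (fun c => cofactor g c a / det3 g * g c b) = kron a b.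
Proof.
intros H. unfold sum3.
transitivity ((cofactor g c1 a * g c1 b + cofactor g c2 a * g c2 b + cofactor g c3 a * g c3 b)
  / det3 g); [now field|].
apply Rmult_eq_reg_r with (det3 g); trivial. unfold Rdiv.
rewrite Rmult_assoc, Rinv_l, Rmult_1_r by trivial.
unfold det3, sum3, cofactor. destruct a, b; simpl; ring.
Qed.

Lemma cofactor_inverse_r (g : idx -> idx -> R) (a b : idx) : det3 g <> 0 ->
  sum3 (fun c => g a c * (cofactor g b c / det3 g)) = kron a b.
Proof.
intros H. unfold sum3.
transitivity ((cofactor g b c1 * g a c1 + cofactor g b c2 * g a c2 + cofactor g b c3 * g a c3)
  / det3 g); [now field|].
apply Rmult_eq_reg_r with (det3 g); trivial. unfold Rdiv.
rewrite Rmult_assoc, Rinv_l, Rmult_1_r by trivial.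
unfold det3, sum3, cofactor. destruct a, b; simpl; ring.
Qed.

(* In the next three lemmas [P a b] stands for the derivative of the component X^b of a
   vector field in the direction a, [Q a b c] for the second derivatives of X^c, and a prime
   for the derivative along X.  [W a b d] is twice the Christoffel symbol of the first kind. *)
Lemma lie_derivative_inverse (g gi g' gi' P : idx -> idx -> R) :
  (forall a b, sum3 (fun c => gi a c * g c b) = kron a b) ->
  (forall a b, sum3 (fun c => g a c * gi c b) = kron a b) ->
  (forall a b, sum3 (fun c => gi' a c * g c b + gi a c * g' c b) = 0) ->
  (forall a b, g' a b = - sum3 (fun c => g c b * P a c + g a c * P b c)) ->
  forall a b, gi' a b = sum3 (fun d => gi d b * P d a + gi a d * P d b).
Proof.
intros Hl Hr Hd Hg a b.
transitivity (sum3 (fun c => gi' a c * sum3 (fun d => g c d * gi d b))).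
{ rewrite <- (sum3_kron_r (gi' a) b) at 1. apply sum3_ext; intros c. now rewrite Hr. }
(* The differentiated inverse relation exchanges gi' g for - gi g', that is, gi' = - gi g' gi. *)
transitivity (sum3 (fun d => - sum3 (fun c => gi a c * g' c d) * gi d b)).
{ transitivity (sum3 (fun d => (sum3 (fun c => gi' a c * g c d + gi a c * g' c d)
      - sum3 (fun c => gi a c * g' c d)) * gi d b)).
  - unfold sum3; ring.
  - apply sum3_ext; intros d. rewrite Hd. ring. }
(* Once the Killing equation is inserted for g', each of the two terms contains g next to its
   inverse, which collapses to the identity. *)
transitivity (sum3 (fun c => gi a c * sum3 (fun f => P c f * sum3 (fun d => g f d * gi d b)))
  + sum3 (fun d => gi d b * sum3 (fun f => sum3 (fun c => gi a c * g c f) * P d f))).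
{ unfold sum3 at 1 2. rewrite !Hg. unfold sum3. ring. }
transitivity (sum3 (fun c => gi a c * P c b) + sum3 (fun d => gi d b * P d a)).
{ f_equal; apply sum3_ext; intros c; f_equal.
  - rewrite <- (sum3_kron_r (P c) b). apply sum3_ext; intros f. now rewrite Hr.
  - rewrite <- (sum3_kron_l (P c) a). apply sum3_ext; intros f. now rewrite Hl. }
unfold sum3; ring.
Qed.

(** This is the vanishing of the Lie derivative of the Levi-Civita connection. The terms of [gi']
    and [W'] in which [P] acts on the raised index cancel; the others give the tensorial part, and
    [gi * g = 1] frees [Q], which is present because Christoffel symbols do not form a tensor. *)
Lemma lie_derivative_christoffel (g gi gi' P : idx -> idx -> R)
    (W W' Q : idx -> idx -> idx -> R) :
  (forall a b, sum3 (fun c => gi a c * g c b) = kron a b) ->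
  (forall a b, gi' a b = sum3 (fun d => gi d b * P d a + gi a d * P d b)) ->
  (forall a b d, W' a b d = - sum3 (fun f => W f b d * P a f + W a f d * P b f + W a b f * P d f)
                            - 2 * sum3 (fun f => g d f * Q a b f)) ->
  let Gam := fun c a b => / 2 * sum3 (fun d => gi c d * W a b d) in
  forall c a b,
    / 2 * sum3 (fun d => gi' c d * W a b d + gi c d * W' a b d)
    = sum3 (fun f => Gam f a b * P f c - Gam c f b * P a f - Gam c a f * P b f) - Q a b c.
Proof.
intros Hl Hgi HW Gam c a b.
transitivity (sum3 (fun f => Gam f a b * P f c - Gam c f b * P a f - Gam c a f * P b f)
  - sum3 (fun f => sum3 (fun d => gi c d * g d f) * Q a b f)).
{ unfold Gam, sum3 at 1. rewrite !Hgi, !HW. unfold sum3. field. }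
f_equal. rewrite <- (sum3_kron_l (Q a b) c). apply sum3_ext; intros f. now rewrite Hl.
Qed.

(** The terms in which [P] acts on the two contracted indices occur once from [gi'] and once, with
    opposite sign, from [Gam']; the free upper index and the trace of [Q] remain. *)
Lemma lie_derivative_contracted_christoffel (gi gi' P : idx -> idx -> R)
    (Gam Gam' Q : idx -> idx -> idx -> R) :
  (forall a b, gi' a b = sum3 (fun d => gi d b * P d a + gi a d * P d b)) ->
  (forall c a b, Gam' c a b
    = sum3 (fun f => Gam f a b * P f c - Gam c f b * P a f - Gam c a f * P b f) - Q a b c) ->
  forall c,
    sum3 (fun a => sum3 (fun b => gi' a b * Gam c a b + gi a b * Gam' c a b))
    = sum3 (fun f => sum3 (fun a => sum3 (fun b => gi a b * Gam f a b)) * P f c)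
      - sum3 (fun a => sum3 (fun b => gi a b * Q a b c)).
Proof.
intros Hgi HG c. unfold sum3 at 1 2. rewrite !Hgi, !HG. unfold sum3. ring.
Qed.

Section Killing.

Variables (U : pt -> Prop) (g : idx -> idx -> pt -> R) (X : vfield).
Hypotheses (HU : open U) (Hg : forall a b, smooth U (g a b))
  (HX : forall a, smooth U (cmp X a))
  (Hsym : forall a b p, g a b p = g b a p)
  (HK : invariant2 U X g).

Definition along (f : pt -> R) (p : pt) : R := sum3 (fun c => cmp X c p * pd c f p).

Lemma killing_along (a b : idx) (p : pt) : U p ->
  along (g a b) p
  = - sum3 (fun c => g c b p * pd a (cmp X c) p + g a c p * pd b (cmp X c) p).
Proof.
intros Hp. generalize (HK a b p Hp). unfold lie2, along, sum3. lra.
Qed.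

Definition chris1 (a b d : idx) (p : pt) : R :=
  pd a (g d b) p + pd b (g d a) p - pd d (g a b) p.

Lemma smooth_chris1 (a b d : idx) : smooth U (chris1 a b d).
Proof.
apply smooth_minus; trivial; [apply smooth_plus; trivial|]; now apply smooth_pd.
Qed.

(** The Killing equation for the component (d, b), valid on the whole open set, is differentiated in
    the direction [a]; the derivatives of the metric are reordered so that X again acts last. *)
Lemma killing_prolonged (a d b : idx) (p : pt) : U p ->
  sum3 (fun c => pd a (cmp X c) p * pd c (g d b) p + cmp X c p * pd c (pd a (g d b)) p
    + pd a (g c b) p * pd d (cmp X c) p + g c b p * pd a (pd d (cmp X c)) p
    + pd a (g d c) p * pd b (cmp X c) p + g d c p * pd a (pd b (cmp X c)) p) = 0.
Proof.
intros Hp.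
assert (Hs : forall f, smooth U f -> has_pd a f p) by (intros; now apply (smooth_has_pd U)).
rewrite <- (pd_const a 0 p), <- (pd_ext U (lie2 X g d b) (fun _ => 0) HU
  (fun q Hq => HK d b q Hq) a p Hp).
unfold lie2.
rewrite pd_sum3.
- apply sum3_ext; intros c.
  rewrite !pd_plus, !pd_mult, (pd_comm U (g d b) a c) by
    auto using has_pd_mult, has_pd_plus, smooth_pd. ring.
- intros c. auto 7 using has_pd_mult, has_pd_plus, smooth_pd.
Qed.

Lemma killing_along_chris1 (a b d : idx) (p : pt) : U p ->
  along (chris1 a b d) p
  = - sum3 (fun f => chris1 f b d p * pd a (cmp X f) p + chris1 a f d p * pd b (cmp X f) p
                     + chris1 a b f p * pd d (cmp X f) p)
    - 2 * sum3 (fun f => g d f p * pd a (pd b (cmp X f)) p).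
Proof.
intros Hp.
assert (Hs : forall c f, smooth U f -> has_pd c f p) by (intros; now apply (smooth_has_pd U)).
assert (H : forall c, pd c (chris1 a b d) p
  = pd c (pd a (g d b)) p + pd c (pd b (g d a)) p - pd c (pd d (g a b)) p).
{ intros c. unfold chris1. rewrite pd_minus, pd_plus;
    auto using has_pd_plus, smooth_pd. }
unfold along.
rewrite (sum3_ext _ (fun c => cmp X c p * (pd c (pd a (g d b)) p + pd c (pd b (g d a)) p
   - pd c (pd d (g a b)) p))) by (intros; now rewrite H).
(* The combination [E1 + E2 - E3] repeats the signs of [chris1]. In it the second derivatives of X
   contracted with index [a] or [b] of the metric cancel, and those contracted with index [d]
   double. *)
assert (E1 := killing_prolonged a d b p Hp).
assert (E2 := killing_prolonged b d a p Hp).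
assert (E3 := killing_prolonged d a b p Hp).
assert (Hgs : forall c f, g c f = g f c)
  by (intros; apply functional_extensionality; intros; apply Hsym).
assert (HQ : forall c, pd b (pd a (cmp X c)) p = pd a (pd b (cmp X c)) p
   /\ pd d (pd a (cmp X c)) p = pd a (pd d (cmp X c)) p
   /\ pd d (pd b (cmp X c)) p = pd b (pd d (cmp X c)) p)
  by (intros c; repeat split; now apply (pd_comm U)).
unfold sum3 in *. unfold chris1.
destruct (HQ c1) as [Q1 [Q2 Q3]], (HQ c2) as [Q4 [Q5 Q6]], (HQ c3) as [Q7 [Q8 Q9]].
rewrite Q1, Q4, Q7 in E2. rewrite Q2, Q3, Q5, Q6, Q8, Q9 in E3.
rewrite !(fun c => Hgs c a) in *. rewrite !(fun c => Hgs c b) in *.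
rewrite !(fun c => Hgs c d) in *.
lra.
Qed.

End Killing.

Lemma along_mult (U : pt -> Prop) (X : vfield) (f h : pt -> R) (p : pt) :
  smooth U f -> smooth U h -> U p ->
  along X (fun q => f q * h q) p = along X f p * h p + f p * along X h p.
Proof.
intros Hf Hh Hp. unfold along, sum3. rewrite !pd_mult; try (now apply (smooth_has_pd U)). ring.
Qed.

Lemma along_scal (X : vfield) (k : R) (f : pt -> R) (p : pt) :
  along X (fun q => k * f q) p = k * along X f p.
Proof. unfold along, sum3. rewrite !pd_scal. ring. Qed.

Lemma along_sum3 (U : pt -> Prop) (X : vfield) (f : idx -> pt -> R) (p : pt) :
  (forall b, smooth U (f b)) -> U p ->
  along X (fun q => sum3 (fun b => f b q)) p = sum3 (fun b => along X (f b) p).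
Proof.
intros Hf Hp. unfold along. unfold sum3 at 1.
rewrite !pd_sum3 by (intros; now apply (smooth_has_pd U)). unfold sum3; ring.
Qed.

Definition smooth_map (U : pt -> Prop) (x : pt -> R13) : Prop :=
  smooth U (fun q => fst (fst (fst (x q)))) /\ smooth U (fun q => snd (fst (fst (x q)))) /\
  smooth U (fun q => snd (fst (x q))) /\ smooth U (fun q => snd (x q)).

Section Chart.

Variables (U : pt -> Prop) (x : pt -> R13).
Hypotheses (HU : open U) (Hx : smooth_map U x) (Hdet : forall p, U p -> gdet x p <> 0).

Lemma smooth_metric (a b : idx) : smooth U (metric x a b).
Proof.
destruct Hx as [H1 [H2 [H3 H0]]]. unfold metric, tangent, mink.
repeat apply smooth_minus; trivial; apply smooth_mult; trivial; now apply smooth_pd.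
Qed.

Lemma metric_sym (a b : idx) (p : pt) : metric x a b p = metric x b a p.
Proof. unfold metric, tangent, mink. ring. Qed.

Lemma smooth_cofactor_metric (a b : idx) :
  smooth U (fun p => cofactor (fun a b => metric x a b p) a b).
Proof.
apply smooth_minus; trivial; apply smooth_mult; trivial; apply smooth_metric.
Qed.

Lemma smooth_ginv (a b : idx) : smooth U (ginv x a b).
Proof.
apply smooth_mult; trivial; [apply smooth_cofactor_metric|].
apply smooth_inv; trivial. apply smooth_sum3; trivial.
intros c. apply smooth_mult; trivial; [apply smooth_metric | apply smooth_cofactor_metric].
Qed.

Lemma ginv_metric (a b : idx) (p : pt) : U p ->
  sum3 (fun c => ginv x a c p * metric x c b p) = kron a b.
Proof.
intros Hp. exact (cofactor_inverse_l (fun a b => metric x a b p) a b (Hdet p Hp)).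
Qed.

Lemma metric_ginv (a b : idx) (p : pt) : U p ->
  sum3 (fun c => metric x a c p * ginv x c b p) = kron a b.
Proof.
intros Hp. exact (cofactor_inverse_r (fun a b => metric x a b p) a b (Hdet p Hp)).
Qed.

Lemma smooth_christoffel (c a b : idx) : smooth U (christoffel x c a b).
Proof.
apply smooth_mult; trivial; [apply smooth_const|]. apply smooth_sum3; trivial.
intros d. apply smooth_mult; trivial; [apply smooth_ginv|].
apply (smooth_chris1 U (metric x)); trivial. apply smooth_metric.
Qed.

Definition contracted_christoffel (c : idx) (p : pt) : R :=
  sum3 (fun a => sum3 (fun b => ginv x a b p * christoffel x c a b p)).

Lemma smooth_contracted_christoffel (c : idx) : smooth U (contracted_christoffel c).
Proof.
do 2 (apply smooth_sum3; trivial; intros ?). apply smooth_mult; trivial;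
  [apply smooth_ginv | apply smooth_christoffel].
Qed.

Variable X : vfield.
Hypotheses (HX : forall a, smooth U (cmp X a)) (HK : invariant2 U X (metric x)).

Lemma killing_along_ginv (a b : idx) (p : pt) : U p ->
  along X (ginv x a b) p
  = sum3 (fun d => ginv x d b p * pd d (cmp X a) p + ginv x a d p * pd d (cmp X b) p).
Proof.
intros Hp.
apply (lie_derivative_inverse (fun a b => metric x a b p) (fun a b => ginv x a b p)
  (fun a b => along X (metric x a b) p) (fun a b => along X (ginv x a b) p)
  (fun a b => pd a (cmp X b) p)).
- intros; now apply ginv_metric.
- intros; now apply metric_ginv.
- intros c d.
  (* The product of the metric and its inverse is constant on [U], so its derivative along X
     vanishes. *)
  transitivity (along X (fun q => sum3 (fun f => ginv x c f q * metric x f d q)) p).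
  + rewrite (along_sum3 U); trivial.
    * apply sum3_ext; intros f. symmetry.
      apply (along_mult U); trivial; [apply smooth_ginv | apply smooth_metric].
    * intros f. apply smooth_mult; trivial; [apply smooth_ginv | apply smooth_metric].
  + unfold along, sum3.
    rewrite !(pd_ext U (fun q => sum3 (fun f => ginv x c f q * metric x f d q))
      (fun _ => kron c d)) by (trivial; intros; now apply ginv_metric).
    rewrite !pd_const. ring.
- intros c d. now apply (killing_along U).
Qed.

Lemma killing_along_christoffel (c a b : idx) (p : pt) : U p ->
  along X (christoffel x c a b) p
  = sum3 (fun f => christoffel x f a b p * pd f (cmp X c) p
                   - christoffel x c f b p * pd a (cmp X f) p
                   - christoffel x c a f p * pd b (cmp X f) p) - pd a (pd b (cmp X c)) p.
Proof.
intros Hp.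
assert (HW : forall a b d, smooth U (chris1 (metric x) a b d))
  by (intros; apply smooth_chris1; trivial; apply smooth_metric).
transitivity (/ 2 * sum3 (fun d => along X (ginv x c d) p * chris1 (metric x) a b d p
                + ginv x c d p * along X (chris1 (metric x) a b d) p)).
{ unfold christoffel. rewrite along_scal. f_equal.
  rewrite (along_sum3 U X (fun d q => ginv x c d q * chris1 (metric x) a b d q)); trivial.
  - apply sum3_ext; intros d. apply (along_mult U); trivial. apply smooth_ginv.
  - intros d. apply smooth_mult; trivial. apply smooth_ginv. }
apply (lie_derivative_christoffel (fun a b => metric x a b p) (fun a b => ginv x a b p)
  (fun a b => along X (ginv x a b) p) (fun a b => pd a (cmp X b) p)
  (fun a b d => chris1 (metric x) a b d p) (fun a b d => along X (chris1 (metric x) a b d) p)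
  (fun a b f => pd a (pd b (cmp X f)) p)).
- intros; now apply ginv_metric.
- intros; now apply killing_along_ginv.
- intros; apply (killing_along_chris1 U); trivial; [apply smooth_metric | apply metric_sym].
Qed.

Lemma killing_along_contracted_christoffel (c : idx) (p : pt) : U p ->
  along X (contracted_christoffel c) p
  = sum3 (fun f => contracted_christoffel f p * pd f (cmp X c) p)
    - sum3 (fun a => sum3 (fun b => ginv x a b p * pd a (pd b (cmp X c)) p)).
Proof.
intros Hp.
assert (Hs : forall c a b, smooth U (fun q => ginv x a b q * christoffel x c a b q))
  by (intros; apply smooth_mult; trivial; [apply smooth_ginv | apply smooth_christoffel]).
unfold contracted_christoffel.
rewrite <- (lie_derivative_contracted_christoffel (fun a b => ginv x a b p)
  (fun a b => along X (ginv x a b) p) (fun a b => pd a (cmp X b) p)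
  (fun c a b => christoffel x c a b p) (fun c a b => along X (christoffel x c a b) p)
  (fun a b f => pd a (pd b (cmp X f)) p)).
- rewrite (along_sum3 U) by (trivial; intros; now apply smooth_sum3).
  apply sum3_ext; intros a. rewrite (along_sum3 U) by trivial.
  apply sum3_ext; intros b.
  apply (along_mult U); trivial; [apply smooth_ginv | apply smooth_christoffel].
- intros; now apply killing_along_ginv.
- intros; now apply killing_along_christoffel.
Qed.

Section Operators.

Variables (zeta m e : R) (A : one_form) (F : two_form) (chi : pt -> R).
Hypotheses (HA : forall a, smooth U (A a))
  (HF : forall a b q, U q -> dform A a b q = F a b q)
  (Hchi : smooth U chi)
  (Hdchi : forall c q, U q -> pd c chi q = - contract F X c q).

Let D := Dcov e A.
Let XX := first_order e A X chi.

(** With the Christoffel symbols summed against the inverse metric, the only variable coefficients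
    are [ginv] and [contracted_christoffel]; their derivatives along X are all the commutator
    needs. *)
Lemma KG_expand (phi : pt -> C) :
  KG x zeta m e A phi
  = (fun q => Csum3 (fun a => Csum3 (fun b => RtoC (ginv x a b q) * D a (D b phi) q)
                              + RtoC (- contracted_christoffel a q) * D a phi q)
              + RtoC (zeta * scalar_curvature + m ^ 2) * phi q)%C.
Proof.
apply functional_extensionality; intros q.
assert (H2 : forall a b, Dcov2 x e A a b phi q
  = (D a (D b phi) q - Csum3 (fun c => RtoC (christoffel x c a b q) * D c phi q))%C)
  by (intros; unfold Dcov2, D; unfold Dcov at 4; ring).
unfold KG, Csum3 at 1 2 3 4. rewrite !H2. unfold Csum3, contracted_christoffel, sum3.
rewrite !RtoC_opp, !RtoC_plus, !RtoC_mult. ring.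
Qed.

(** [Dcov_first_order] is used for [phi] under the outer derivative and then for [D b phi]; the
    second derivatives of X arise where the outer derivative hits the coefficients left by the first
    use. *)
Lemma Dcov2_first_order (a b : idx) (phi : pt -> C) (p : pt) :
  Csmooth U phi -> U p ->
  D a (D b (XX phi)) p
  = (XX (D a (D b phi)) p
     + Csum3 (fun d => RtoC (pd a (cmp X d) p) * D d (D b phi) p
                       + RtoC (pd b (cmp X d) p) * D a (D d phi) p
                       + RtoC (pd a (pd b (cmp X d)) p) * D d phi p))%C.
Proof.
intros Hphi Hp.
assert (HD := fun psi c => Csmooth_Dcov U e A HU HA c psi). fold D in HD.
assert (HXX : Csmooth U (XX (D b phi))) by (apply Csmooth_first_order; auto).
unfold D at 1.
rewrite (Dcov_ext U e A HU _ (fun q => XX (D b phi) q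
     + Csum3 (fun d => RtoC (pd b (cmp X d) q) * D d phi q))%C) by
  (trivial; intros; now apply (Dcov_first_order U e A HU HA X chi F)).
rewrite (Dcov_plus U), (Dcov_sum3 U) by
  (auto using Csmooth_sum3, Csmooth_rmult, smooth_pd).
unfold XX. rewrite (Dcov_first_order U e A HU HA X chi F) by auto.
fold D XX. unfold Csum3.
unfold D in *. rewrite !(Dcov_rmult U) by (auto using smooth_pd). ring.
Qed.

Lemma first_order_KG (phi : pt -> C) (p : pt) : Csmooth U phi -> U p ->
  XX (KG x zeta m e A phi) p
  = (Csum3 (fun a => Csum3 (fun b => RtoC (along X (ginv x a b) p) * D a (D b phi) p
                                     + RtoC (ginv x a b p) * XX (D a (D b phi)) p)
                     - RtoC (along X (contracted_christoffel a) p) * D a phi p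
                     - RtoC (contracted_christoffel a p) * XX (D a phi) p)
     + RtoC (zeta * scalar_curvature + m ^ 2) * XX phi p)%C.
Proof.
intros Hphi Hp. rewrite KG_expand.
assert (HD := fun psi c => Csmooth_Dcov U e A HU HA c psi). fold D in HD.
assert (Hgi := smooth_ginv). assert (HG := smooth_contracted_christoffel).
assert (HG' : forall a, smooth U (fun q => - contracted_christoffel a q))
  by (intros; now apply smooth_opp).
assert (Hk := smooth_const U (zeta * scalar_curvature + m ^ 2)).
assert (Hgi' : forall a b, Csmooth U (fun q => RtoC (ginv x a b q) * D a (D b phi) q)%C)
  by (auto using Csmooth_rmult).
assert (HG2 : forall a, Csmooth U (fun q => RtoC (- contracted_christoffel a q) * D a phi q)%C)
  by (intros; apply Csmooth_rmult; auto).
assert (HS : forall a,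
  Csmooth U (fun q => Csum3 (fun b => RtoC (ginv x a b q) * D a (D b phi) q))%C)
  by (intros; apply Csmooth_sum3; auto).
unfold XX.
rewrite (first_order_plus U) by first [assumption |
  apply Csmooth_sum3; trivial; intros; now apply Csmooth_plus |
  now apply (Csmooth_rmult U (fun _ => zeta * scalar_curvature + m ^ 2))].
rewrite (first_order_sum3 U) by (trivial; intros; now apply Csmooth_plus).
rewrite (first_order_rmult U e A X chi (fun _ => zeta * scalar_curvature + m ^ 2)) by trivial.
f_equal.
- unfold Csum3 at 1 3.
  rewrite !(first_order_plus U) by trivial.
  rewrite !(first_order_sum3 U) by auto.
  unfold Csum3.
  rewrite !(first_order_rmult U) by auto. fold XX.
  assert (Ho : forall c, sum3 (fun a => cmp X a p * pd a (fun q => - contracted_christoffel c q) p)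
    = - along X (contracted_christoffel c) p)
    by (intros; unfold along, sum3; rewrite !pd_opp; ring).
  rewrite !Ho. unfold along. rewrite !RtoC_opp. ring.
- unfold sum3. rewrite !pd_const, !RtoC_plus, !RtoC_mult. ring.
Qed.

(** The terms in which [XX] acts on derivatives of [phi] are the same in both orders, and so is the
    constant term. The second-order remainder cancels against the derivative of [ginv] along X. The
    first-order remainder, with its second derivatives of X, cancels against that of
    [contracted_christoffel]. *)
Lemma killing_symmetry_operator : symmetry_operator U (KG x zeta m e A) XX.
Proof.
intros phi Hphi p Hp. unfold commutator, op_zero.
rewrite first_order_KG, KG_expand by trivial.
unfold Csum3 at 1 3.
unfold Csum3 at 1 2 3 4 5 6.
rewrite !Dcov2_first_order by trivial.
rewrite !(fun b => Dcov_first_order U e A HU HA X chi F b phi p) by trivial.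
rewrite !killing_along_ginv, !killing_along_contracted_christoffel by trivial.
unfold Csum3, sum3. fold D XX.
rewrite !RtoC_opp.
repeat rewrite ?RtoC_plus, ?RtoC_minus, ?RtoC_mult.
ring.
Qed.

End Operators.
End Chart.

(** * Isometries of de Sitter space *)

(* The element of so(1,3) with boost parameters b1, b2, b3 and rotation parameters
   r1, r2, r3. *)
Definition so13 (b1 b2 b3 r1 r2 r3 : R) (v : R13) : R13 :=
  let '(v1, v2, v3, v0) := v in
  (r2 * v3 - r3 * v2 + b1 * v0, r3 * v1 - r1 * v3 + b2 * v0,
   r1 * v2 - r2 * v1 + b3 * v0, b1 * v1 + b2 * v2 + b3 * v3).

Definition push_forward (x : pt -> R13) (X : vfield) (p : pt) : R13 :=
  (sum3 (fun c => cmp X c p * pd c (fun q => fst (fst (fst (x q)))) p),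
   sum3 (fun c => cmp X c p * pd c (fun q => snd (fst (fst (x q)))) p),
   sum3 (fun c => cmp X c p * pd c (fun q => snd (fst (x q))) p),
   sum3 (fun c => cmp X c p * pd c (fun q => snd (x q)) p)).

(** The equation X(f) = h is differentiated and the mixed partial derivatives are exchanged. Applied
    to the ambient coordinates it tells how X acts on the components of the tangent vectors. *)
Lemma pd_along (U : pt -> Prop) (X : vfield) (f h : pt -> R) (a : idx) (p : pt) :
  open U -> (forall c, smooth U (cmp X c)) -> smooth U f ->
  (forall q, U q -> along X f q = h q) -> U p ->
  sum3 (fun c => cmp X c p * pd c (pd a f) p)
  = pd a h p - sum3 (fun c => pd a (cmp X c) p * pd c f p).
Proof.
intros HU HX Hf Hh Hp.
rewrite <- (pd_ext U _ _ HU Hh) by trivial. unfold along.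
assert (Hs : forall c h, smooth U h -> has_pd c h p) by (intros; now apply (smooth_has_pd U)).
rewrite pd_sum3 by (intros; apply has_pd_mult; auto using smooth_pd).
unfold sum3. rewrite !pd_mult by auto using smooth_pd.
rewrite !(fun c => pd_comm U f c a) by trivial. ring.
Qed.

Lemma pd_lincomb3 (U : pt -> Prop) (k1 k2 k3 : R) (f1 f2 f3 : pt -> R) (a : idx) (p : pt) :
  smooth U f1 -> smooth U f2 -> smooth U f3 -> U p ->
  pd a (fun q => k1 * f1 q + k2 * f2 q + k3 * f3 q) p
  = k1 * pd a f1 p + k2 * pd a f2 p + k3 * pd a f3 p.
Proof.
intros H1 H2 H3 Hp.
assert (Hs : forall k f, smooth U f -> has_pd a (fun q => k * f q) p).
{ intros k f Hf. apply has_pd_mult; [|now apply (smooth_has_pd U)].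
  exact (ex_derive_const k (crd a p)). }
rewrite !pd_plus, !pd_scal; auto using has_pd_plus.
Qed.

(* If the flow of X on U is induced by a one-parameter group of linear isometries, then X
   is a Killing field. *)
Lemma killing_of_so13 (U : pt -> Prop) (x : pt -> R13) (X : vfield) (b1 b2 b3 r1 r2 r3 : R) :
  open U -> smooth_map U x -> (forall a, smooth U (cmp X a)) ->
  (forall p, U p -> push_forward x X p = so13 b1 b2 b3 r1 r2 r3 (x p)) ->
  invariant2 U X (metric x).
Proof.
intros HU [H1 [H2 [H3 H0]]] HX HL a b p Hp.
set (x1 := fun q => fst (fst (fst (x q)))) in *.
set (x2 := fun q => snd (fst (fst (x q)))) in *.
set (x3 := fun q => snd (fst (x q))) in *.
set (x0 := fun q => snd (x q)) in *.
assert (E : forall q, U q ->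
  along X x1 q = r2 * x3 q + - r3 * x2 q + b1 * x0 q /\
  along X x2 q = r3 * x1 q + - r1 * x3 q + b2 * x0 q /\
  along X x3 q = r1 * x2 q + - r2 * x1 q + b3 * x0 q /\
  along X x0 q = b1 * x1 q + b2 * x2 q + b3 * x3 q).
{ intros q Hq. generalize (HL q Hq). unfold push_forward, so13, x1, x2, x3, x0.
  destruct (x q) as [[[v1 v2] v3] v0]. intros [= E1 E2 E3 E0].
  unfold along. simpl. rewrite E1, E2, E3, E0. repeat split; ring. }
assert (D1 := fun a q Hq => pd_along U X x1 _ a q HU HX H1 (fun q Hq => proj1 (E q Hq)) Hq).
assert (D2 := fun a q Hq => pd_along U X x2 _ a q HU HX H2
  (fun q Hq => proj1 (proj2 (E q Hq))) Hq).
assert (D3 := fun a q Hq => pd_along U X x3 _ a q HU HX H3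
  (fun q Hq => proj1 (proj2 (proj2 (E q Hq)))) Hq).
assert (D0 := fun a q Hq => pd_along U X x0 _ a q HU HX H0
  (fun q Hq => proj2 (proj2 (proj2 (E q Hq)))) Hq).
simpl in D1, D2, D3, D0.
assert (D : forall c, pd c (metric x a b) p =
    pd c (pd a x0) p * pd b x0 p + pd a x0 p * pd c (pd b x0) p
  - (pd c (pd a x1) p * pd b x1 p + pd a x1 p * pd c (pd b x1) p)
  - (pd c (pd a x2) p * pd b x2 p + pd a x2 p * pd c (pd b x2) p)
  - (pd c (pd a x3) p * pd b x3 p + pd a x3 p * pd c (pd b x3) p)).
{ intros c.
  assert (Hs : forall y, smooth U y -> has_pd c (pd a y) p /\ has_pd c (pd b y) p /\
    smooth U (fun q => pd a y q * pd b y q)).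
  { intros y Hy. split; [|split].
    1,2: apply (smooth_has_pd U); auto using smooth_pd.
    apply smooth_mult; auto using smooth_pd. }
  destruct (Hs x0 H0) as [A0 [B0 C0]], (Hs x1 H1) as [A1 [B1 C1]],
    (Hs x2 H2) as [A2 [B2 C2]], (Hs x3 H3) as [A3 [B3 C3]].
  transitivity (pd c (fun q => pd a x0 q * pd b x0 q - pd a x1 q * pd b x1 q
    - pd a x2 q * pd b x2 q - pd a x3 q * pd b x3 q) p); [reflexivity|].
  rewrite (pd_minus c (fun q => pd a x0 q * pd b x0 q - pd a x1 q * pd b x1 q
    - pd a x2 q * pd b x2 q)),
    (pd_minus c (fun q => pd a x0 q * pd b x0 q - pd a x1 q * pd b x1 q)),
    (pd_minus c (fun q => pd a x0 q * pd b x0 q)), !pd_mult; trivial;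
  apply (smooth_has_pd U); trivial; repeat (apply smooth_minus; trivial). }
assert (Da1 := D1 a p Hp). assert (Db1 := D1 b p Hp).
assert (Da2 := D2 a p Hp). assert (Db2 := D2 b p Hp).
assert (Da3 := D3 a p Hp). assert (Db3 := D3 b p Hp).
assert (Da0 := D0 a p Hp). assert (Db0 := D0 b p Hp).
rewrite (pd_lincomb3 U) in Da1, Db1, Da2, Db2, Da3, Db3, Da0, Db0 by trivial.
(* Grouped this way, X acts on one tangent vector at a time, and [pd_along] replaces the result by L
   applied to that vector minus a term in the derivatives of X. The latter terms cancel the last
   sum; the former cancel because L is antisymmetric for [mink]. *)
transitivity (
    sum3 (fun c => cmp X c p * pd c (pd a x0) p) * pd b x0 p
  + pd a x0 p * sum3 (fun c => cmp X c p * pd c (pd b x0) p)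
  - sum3 (fun c => cmp X c p * pd c (pd a x1) p) * pd b x1 p
  - pd a x1 p * sum3 (fun c => cmp X c p * pd c (pd b x1) p)
  - sum3 (fun c => cmp X c p * pd c (pd a x2) p) * pd b x2 p
  - pd a x2 p * sum3 (fun c => cmp X c p * pd c (pd b x2) p)
  - sum3 (fun c => cmp X c p * pd c (pd a x3) p) * pd b x3 p
  - pd a x3 p * sum3 (fun c => cmp X c p * pd c (pd b x3) p)
  + sum3 (fun c => metric x c b p * pd a (cmp X c) p + metric x a c p * pd b (cmp X c) p)).
- unfold lie2, sum3. rewrite !D. ring.
- rewrite Da1, Db1, Da2, Db2, Da3, Db3, Da0, Db0. unfold sum3, metric, tangent, mink.
  fold x1 x2 x3 x0. ring.
Qed.

(** * Closed invariant 2-forms *)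

Lemma invariant_form (U : pt -> Prop) (F : two_form) (X : vfield) (chi : pt -> R) :
  open U -> (forall a, smooth U (cmp X a)) -> smooth U chi ->
  (forall a b, smooth U (F a b)) -> (forall a b p, F a b p = - F b a p) -> closed2 U F ->
  (forall b p, U p -> pd b chi p = - contract F X b p) -> invariant2 U X F.
Proof.
intros HU HX Hchi HF Hanti Hcl Hd a b p Hp.
assert (Hs : forall c h, smooth U h -> has_pd c h p) by (intros; now apply (smooth_has_pd U)).
assert (H : forall a b, pd a (pd b chi) p
  = - sum3 (fun c => pd a (cmp X c) p * F c b p + cmp X c p * pd a (F c b) p)).
{ intros c d. rewrite (pd_ext U (pd d chi) (fun q => - contract F X d q)) by auto.
  rewrite pd_opp. unfold contract.
  rewrite pd_sum3 by (intros; apply has_pd_mult; auto).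
  f_equal. apply sum3_ext; intros. apply pd_mult; auto. }
assert (Hab := pd_comm U chi a b p HU Hchi Hp). rewrite !H in Hab.
assert (Ho : forall a b c, pd a (F b c) p = - pd a (F c b) p).
{ intros c d f. rewrite <- pd_opp. f_equal. apply functional_extensionality; intros; apply Hanti. }
assert (C1 := Hcl c1 a b p Hp). assert (C2 := Hcl c2 a b p Hp). assert (C3 := Hcl c3 a b p Hp).
rewrite (Ho a b) in C1, C2, C3.
unfold lie2. unfold sum3 in *.
rewrite (Hanti a c1), (Hanti a c2), (Hanti a c3).
(* Weighted by the components of X, the three closedness equations add up to the contraction of dF
   with X, the other half of Cartan's formula. *)
apply (f_equal (Rmult (cmp X c1 p))) in C1. apply (f_equal (Rmult (cmp X c2 p))) in C2.
apply (f_equal (Rmult (cmp X c3 p))) in C3.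
lra.
Qed.

(** A normal form in which antisymmetry is built in, closedness is a single equation, and components
    reduce by computation. *)
Definition two_form_of (f12 f13 f23 : pt -> R) : two_form :=
  fun a b p =>
    match a, b with
    | c1, c2 => f12 p | c2, c1 => - f12 p
    | c1, c3 => f13 p | c3, c1 => - f13 p
    | c2, c3 => f23 p | c3, c2 => - f23 p
    | _, _ => 0
    end.

Lemma two_form_of_anti (f12 f13 f23 : pt -> R) (a b : idx) (p : pt) :
  two_form_of f12 f13 f23 a b p = - two_form_of f12 f13 f23 b a p.
Proof. destruct a, b; simpl; ring. Qed.

Lemma smooth_two_form_of (U : pt -> Prop) (f12 f13 f23 : pt -> R) (a b : idx) :
  open U -> smooth U f12 -> smooth U f13 -> smooth U f23 ->
  smooth U (two_form_of f12 f13 f23 a b).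
Proof.
intros HU H1 H2 H3.
destruct a, b; unfold two_form_of; auto using smooth_opp, smooth_const.
Qed.

Lemma closed_two_form_of (U : pt -> Prop) (f12 f13 f23 : pt -> R) :
  (forall p, U p -> pd c1 f23 p - pd c2 f13 p + pd c3 f12 p = 0) ->
  closed2 U (two_form_of f12 f13 f23).
Proof.
intros H a b c p Hp. generalize (H p Hp).
destruct a, b, c; unfold two_form_of; rewrite ?pd_opp, ?pd_const; simpl;
  try change (fun p0 => f12 p0) with f12; try change (fun p0 => f13 p0) with f13;
  try change (fun p0 => f23 p0) with f23; lra.
Qed.

(** * From generators to the symmetry algebra *)

Definition symmetry_generator (U : pt -> Prop) (x : pt -> R13) (F : two_form)
    (g : vfield * (pt -> R)) : Prop :=
  (forall a, smooth U (cmp (fst g) a)) /\ smooth U (snd g) /\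
  invariant2 U (fst g) (metric x) /\
  (forall b p, U p -> pd b (snd g) p = - contract F (fst g) b p).

(** The indexing follows [basis_op]: position 0 holds the pair (0, 1) of X_0, and the default (0, 0)
    corresponds to [op_zero], so the two agree for every [j]. *)
Definition generator (gens : list (vfield * (pt -> R))) (j : nat) : vfield * (pt -> R) :=
  nth j (((fun _ => (0, 0, 0)), (fun _ => 1)) :: gens) ((fun _ => (0, 0, 0)), (fun _ => 0)).

Definition gen_field gens j := fst (generator gens j).
Definition gen_potential gens j := snd (generator gens j).

(* X_0 = ie is the first-order operator with zero vector field and chi = 1. *)
Lemma basis_op_generator (e : R) (A : one_form) (gens : list (vfield * (pt -> R))) (j : nat) :
  basis_op e A gens j = first_order e A (gen_field gens j) (gen_potential gens j).
Proof.
unfold basis_op, gen_field, gen_potential, generator.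
apply functional_extensionality; intros phi; apply functional_extensionality; intros p.
destruct j as [|j]; simpl.
- unfold ie_op, first_order, Csum3, cmp; simpl. apply C_ext; simpl; ring.
- revert j; induction gens as [|g gens IH]; intros [|j]; simpl; try reflexivity;
    try apply IH; unfold op_zero, first_order, Csum3, cmp; simpl; apply C_ext; simpl; ring.
Qed.

Lemma symmetry_generator_const (U : pt -> Prop) (x : pt -> R13) (F : two_form) (c : R) :
  symmetry_generator U x F ((fun _ => (0, 0, 0)), (fun _ => c)).
Proof.
split; [|split; [|split]]; simpl.
- intros []; exact (smooth_const U 0).
- exact (smooth_const U c).
- intros a b p Hp. unfold lie2, sum3, cmp. simpl.
  rewrite !(fun d => pd_const d 0). ring.
- intros b p Hp. rewrite pd_const. unfold contract, sum3, cmp; simpl. ring.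
Qed.

Lemma symmetry_generator_nth (U : pt -> Prop) (x : pt -> R13) (F : two_form)
    (gens : list (vfield * (pt -> R))) (j : nat) :
  (forall g, In g gens -> symmetry_generator U x F g) ->
  symmetry_generator U x F (generator gens j).
Proof.
intros H. unfold generator.
destruct (nth_in_or_default j (((fun _ : pt => (0, 0, 0)), (fun _ : pt => 1)) :: gens)
  ((fun _ => (0, 0, 0)), (fun _ => 0))) as [[<-|Hin]| ->].
- apply symmetry_generator_const.
- now apply H.
- apply symmetry_generator_const.
Qed.

Lemma pd_crd (a b : idx) (p : pt) : pd a (crd b) p = kron a b.
Proof.
etransitivity; [exact (is_derive_unique _ _ _ (is_derive_crd a b p))|]. now destruct a, b.
Qed.

(** On a real function the potential and [chi] contribute only imaginary terms. With [f] a
    coordinate this reads off a component of X, whatever the gauge. *)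
Lemma first_order_Re (e : R) (A : one_form) (X : vfield) (chi f : pt -> R) (p : pt) :
  Re (first_order e A X chi (fun q => RtoC (f q)) p) = sum3 (fun b => cmp X b p * pd b f p).
Proof.
unfold first_order, Csum3, sum3, Dcov, Cpd, Re, Im, RtoC. simpl.
change (fun q => f q) with f. ring.
Qed.

Lemma first_order_Im_1 (e : R) (A : one_form) (X : vfield) (chi : pt -> R) (p : pt) :
  Im (first_order e A X chi (fun q => RtoC 1) p)
  = e * (chi p - sum3 (fun b => cmp X b p * A b p)).
Proof.
unfold first_order, Csum3, sum3, Dcov, Cpd, Re, Im, RtoC. simpl. rewrite !pd_const. ring.
Qed.

Lemma Re_sum_n (c : nat -> R) (z : nat -> C) (n : nat) :
  Re (sum_n (fun j => (RtoC (c j) * z j)%C) n) = sum_n (fun j => c j * Re (z j)) n.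
Proof.
induction n as [|n IH]; [rewrite !sum_O; simpl; unfold Re; ring|].
rewrite !sum_Sn, <- IH. unfold plus; simpl. unfold Re, Im; simpl. ring.
Qed.

Lemma Im_sum_n (c : nat -> R) (z : nat -> C) (n : nat) :
  Im (sum_n (fun j => (RtoC (c j) * z j)%C) n) = sum_n (fun j => c j * Im (z j)) n.
Proof.
induction n as [|n IH]; [rewrite !sum_O; simpl; unfold Im; ring|].
rewrite !sum_Sn, <- IH. unfold plus; simpl. unfold Re, Im; simpl. ring.
Qed.

(** Real parts on the coordinate functions turn a relation between operators into one between
    fields, where X_0 contributes zero; this disposes of all indices from 1 on. The imaginary part
    on the constant 1 then leaves c_0 e = 0. *)
Lemma lin_indep_of_fields (U : pt -> Prop) (e : R) (A : one_form)
    (gens : list (vfield * (pt -> R))) :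
  open U -> (exists p, U p) -> e <> 0 ->
  (forall c : nat -> R,
     (forall a p, U p -> sum_n (fun j => c j * cmp (gen_field gens j) a p) (length gens) = 0) ->
     forall j, (1 <= j <= length gens)%nat -> c j = 0) ->
  lin_indep U (length gens) (basis_op e A gens).
Proof.
intros HU [p0 Hp0] He Hind c Hc.
assert (Hpos : forall j, (1 <= j <= length gens)%nat -> c j = 0).
{ apply Hind. intros a p Hp.
  assert (Hs : Csmooth U (fun q => RtoC (crd a q)))
    by (split; simpl; [now apply smooth_crd | apply smooth_const]).
  assert (H := f_equal Re (Hc _ Hs p Hp)). unfold op_zero in H.
  rewrite Re_sum_n in H. etransitivity; [|exact H].
  apply sum_n_ext; intros j. f_equal.
  rewrite basis_op_generator, first_order_Re.
  rewrite <- (sum3_kron_r (fun b => cmp (gen_field gens j) b p) a). apply sum3_ext; intros b.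
  now rewrite pd_crd. }
assert (Hs : Csmooth U (fun q => RtoC 1)) by (split; apply smooth_const).
assert (H := f_equal Im (Hc _ Hs p0 Hp0)). unfold op_zero in H.
rewrite Im_sum_n in H.
assert (Hz : forall k, (k <= length gens)%nat ->
  sum_n (fun j => c j * Im (basis_op e A gens j (fun _ => RtoC 1) p0)) k = c 0%nat * e).
{ induction k as [|k IH]; intros Hk.
  - rewrite sum_O, basis_op_generator, first_order_Im_1.
    unfold sum3, cmp, gen_field, gen_potential; simpl. ring.
  - rewrite sum_Sn, IH, (Hpos (S k)) by lia. unfold plus; simpl. ring. }
rewrite Hz in H by lia.
intros [|j] Hj; [|apply Hpos; lia].
simpl in H. destruct (Rmult_integral _ _ H); tauto.
Qed.

(** Recording the field and the function of a right-hand side reduces a commutation relation to one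
    identity between fields and one between functions. *)
Definition represents (e : R) (A : one_form) (Z : op) (V : vfield) (psi : pt -> R) : Prop :=
  forall phi p, Z phi p = first_order e A V psi phi p.

(** All that varies from case to case is gathered in the hypotheses. Pairs outside [rels] are
    examined for 1 <= j < k only: X_0 has zero field, and both the bracket and F(X_j, X_k) are
    antisymmetric, which settles the remaining pairs. *)
Lemma symmetry_algebra_of_generators (U : pt -> Prop) (x : pt -> R13) (zeta m e : R)
    (F : two_form) (f12 f13 f23 : pt -> R) (gens : list (vfield * (pt -> R)))
    (rels : (nat -> op) -> list (nat * nat * op)) :
  local_chart U x -> e <> 0 -> smooth_map U x -> (forall p, U p -> dS3 (x p)) ->
  (forall a b p, F a b p = two_form_of f12 f13 f23 a b p) ->
  smooth U f12 -> smooth U f13 -> smooth U f23 ->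
  (forall p, U p -> pd c1 f23 p - pd c2 f13 p + pd c3 f12 p = 0) ->
  (forall g, In g gens -> symmetry_generator U x (two_form_of f12 f13 f23) g) ->
  (forall c : nat -> R,
     (forall a p, U p -> sum_n (fun j => c j * cmp (gen_field gens j) a p) (length gens) = 0) ->
     forall j, (1 <= j <= length gens)%nat -> c j = 0) ->
  (forall A j k Z, In (j, k, Z) (rels (basis_op e A gens)) ->
     exists V psi, represents e A Z V psi /\
     forall p, U p ->
       (forall a, lie_bracket (gen_field gens j) (gen_field gens k) a p = cmp V a p) /\
       contract2 (two_form_of f12 f13 f23) (gen_field gens j) (gen_field gens k) p = psi p) ->
  (forall X j k, (1 <= j)%nat -> (j < k)%nat -> (k <= length gens)%nat ->
     ~ In (j, k) (map fst (rels X)) -> ~ In (k, j) (map fst (rels X)) ->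
     forall p, U p ->
       (forall a, lie_bracket (gen_field gens j) (gen_field gens k) a p = 0) /\
       contract2 (two_form_of f12 f13 f23) (gen_field gens j) (gen_field gens k) p = 0) ->
  admits_symmetry_algebra U x zeta m e F gens rels.
Proof.
intros [HU [Hne [_ Hdet]]] He Hx HdS HFeq S12 S13 S23 Hcl Hgen Hind Hrel Hcomm.
assert (HF : F = two_form_of f12 f13 f23) by
  (repeat (apply functional_extensionality; intros ?); apply HFeq).
subst F. clear HFeq. set (F := two_form_of f12 f13 f23) in *.
assert (HFa : forall a b p, F a b p = - F b a p) by (intros; apply two_form_of_anti).
assert (HFs : forall a b, smooth U (F a b)) by (intros; now apply smooth_two_form_of).
assert (HFc : closed2 U F) by now apply closed_two_form_of.
split; [exact HdS|]. split; [exact HFc|]. split.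
- intros X chi Hin. destruct (Hgen _ Hin) as [HX [Hchi [HK Hd]]]. simpl in *.
  split; [exact HK|]. split; [now apply (invariant_form U F X chi)|].
  intros b p Hp. rewrite <- (Hd b p Hp). apply Derive_correct.
  now apply (smooth_has_pd U).
- intros A HA HdA. simpl.
  assert (Hg := fun j => symmetry_generator_nth U x F gens j Hgen).
  assert (Hc : forall j k V psi,
    (forall p, U p ->
       (forall a, lie_bracket (gen_field gens j) (gen_field gens k) a p = cmp V a p) /\
       contract2 F (gen_field gens j) (gen_field gens k) p = psi p) ->
    op_eq U (commutator (basis_op e A gens j) (basis_op e A gens k)) (first_order e A V psi)).
  { intros j k V psi HV phi Hphi p Hp. destruct (HV p Hp) as [HV1 HV2].
    destruct (Hg j) as [X1 [X2 [X3 X4]]], (Hg k) as [Y1 [Y2 [Y3 Y4]]].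
    rewrite !basis_op_generator.
    now apply (commutator_first_order U e A F). }
  split; [|split].
  + intros j Hj. rewrite basis_op_generator. destruct (Hg j) as [X1 [X2 [X3 X4]]].
    now apply (killing_symmetry_operator U x HU Hx Hdet _ X1 X3 zeta m e A F).
  + now apply lin_indep_of_fields.
  + split.
    * intros j k Z Hin phi Hphi p Hp. destruct (Hrel A j k Z Hin) as [V [psi [HZ HV]]].
      rewrite HZ. now apply (Hc j k V psi).
    * intros j k Hj Hk H1 H2.
      assert (H0 : forall p, U p ->
        (forall a, lie_bracket (gen_field gens j) (gen_field gens k) a p
                   = cmp (fun _ => (0, 0, 0)) a p) /\
        contract2 F (gen_field gens j) (gen_field gens k) p = 0).
      { intros p Hp.
        assert (Hz : forall a, cmp (fun _ : pt => (0, 0, 0)) a p = 0)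
          by (intros []; reflexivity).
        assert (Hpd : forall a b, pd b (cmp (fun _ : pt => (0, 0, 0)) a) p = 0)
          by (intros [] b; exact (pd_const b 0 p)).
        assert (Hanti : forall X Y, (forall a, lie_bracket X Y a p = - lie_bracket Y X a p)
           /\ contract2 F X Y p = - contract2 F Y X p).
        { intros X Y. split; [intros a; unfold lie_bracket, sum3; ring|].
          unfold contract2, contract, sum3, F, two_form_of. ring. }
        assert (Hzero : forall Y, (forall a, lie_bracket (gen_field gens 0) Y a p = 0)
           /\ contract2 F (gen_field gens 0) Y p = 0).
        { intros Y. unfold gen_field, generator; simpl. split.
          - intros a. unfold lie_bracket, sum3. rewrite !Hz, !Hpd. ring.
          - unfold contract2, contract, sum3. rewrite !Hz. ring. }
        setoid_rewrite Hz.
        destruct (Nat.eq_dec j 0) as [->|Hj0]; [apply Hzero|].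
        destruct (Nat.eq_dec k 0) as [->|Hk0].
        { destruct (Hanti (gen_field gens j) (gen_field gens 0)) as [B1 B2],
            (Hzero (gen_field gens j)) as [Z1 Z2].
          split; [intros a; rewrite B1, Z1|rewrite B2, Z2]; ring. }
        destruct (lt_eq_lt_dec j k) as [[Hlt|Heq]|Hlt].
        - apply (Hcomm (basis_op e A gens)); trivial; lia.
        - subst k. destruct (Hanti (gen_field gens j) (gen_field gens j)) as [B1 B2].
          split; [intros a; generalize (B1 a)|]; lra.
        - destruct (Hanti (gen_field gens j) (gen_field gens k)) as [B1 B2].
          destruct (Hcomm (basis_op e A gens) k j) with p as [Z1 Z2]; trivial; try lia.
          split; [intros a; rewrite B1, Z1|rewrite B2, Z2]; ring. }
      intros phi Hphi p Hp.
      rewrite (Hc j k (fun _ => (0, 0, 0)) (fun _ => 0) H0 phi Hphi p Hp).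
      unfold first_order, op_zero, Csum3, cmp. apply C_ext; simpl; ring.
Qed.

(** * The subalgebras of so(1,3) *)

Lemma represents_basis (e : R) (A : one_form) (gens : list (vfield * (pt -> R))) (j : nat) :
  represents e A (basis_op e A gens j) (gen_field gens j) (gen_potential gens j).
Proof. intros phi p. now rewrite basis_op_generator. Qed.

Lemma represents_zero (e : R) (A : one_form) :
  represents e A op_zero (fun _ => (0, 0, 0)) (fun _ => 0).
Proof.
intros phi p. unfold first_order, op_zero, Csum3, cmp. apply C_ext; simpl; ring.
Qed.

Lemma represents_scal (e : R) (A : one_form) (r : R) (Z : op) (V : vfield) (psi : pt -> R) :
  represents e A Z V psi ->
  represents e A (op_scal r Z)
    (fun p => (r * cmp V c1 p, r * cmp V c2 p, r * cmp V c3 p)) (fun p => r * psi p).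
Proof.
intros H phi p. unfold op_scal. rewrite H.
unfold first_order, Csum3, cmp at 4 5 6; simpl. rewrite !RtoC_mult. ring.
Qed.

Lemma represents_add (e : R) (A : one_form) (Y Z : op) (V W : vfield) (psi eta : pt -> R) :
  represents e A Y V psi -> represents e A Z W eta ->
  represents e A (op_add Y Z)
    (fun p => (cmp V c1 p + cmp W c1 p, cmp V c2 p + cmp W c2 p, cmp V c3 p + cmp W c3 p))
    (fun p => psi p + eta p).
Proof.
intros H1 H2 phi p. unfold op_add. rewrite H1, H2.
unfold first_order, Csum3, cmp at 7 8 9; simpl. rewrite !RtoC_mult, !RtoC_plus. ring.
Qed.

(* The coordinate functions are abstracted so that unfolding [crd] in a concrete [f] does not
   expose projections of a variable point. *)
Lemma smooth_coordinates (U : pt -> Prop) (f : pt -> R) : open U ->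
  (forall g1 g2 g3, g1 = crd c1 -> g2 = crd c2 -> g3 = crd c3 ->
     smooth U g1 -> smooth U g2 -> smooth U g3 -> smooth U (fun p => f (g1 p, g2 p, g3 p))) ->
  smooth U f.
Proof.
intros HU H.
apply smooth_ext with (fun p => f (crd c1 p, crd c2 p, crd c3 p)); trivial.
- now intros [[q1 q2] q3].
- apply H; auto using smooth_crd.
Qed.

Lemma pd_zero_on (U : pt -> Prop) (f : pt -> R) (a : idx) (p : pt) :
  open U -> (forall q, U q -> f q = 0) -> U p -> pd a f p = 0.
Proof.
intros HU H Hp. rewrite (pd_ext U f (fun _ => 0)); trivial. apply pd_const.
Qed.

(** Oriented as a rewriting rule for [ring] and [field], as is [cosh_sq]: squares of sine and
    hyperbolic cosine are eliminated. *)
Lemma sin_sq (t : R) : sin t ^ 2 = 1 - cos t ^ 2.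
Proof. generalize (sin2_cos2 t). unfold Rsqr. lra. Qed.

(** Once both exponentials are expressed this way, [exp t * exp (- t) = 1] becomes an instance of
    [cosh_sq], and a single rule covers both kinds of function. *)
Lemma exp_cosh_sinh (t : R) : exp t = cosh t + sinh t.
Proof. unfold cosh, sinh. field. Qed.

Lemma exp_opp_cosh_sinh (t : R) : exp (- t) = cosh t - sinh t.
Proof. unfold cosh, sinh. field. Qed.

Lemma cosh_sq (t : R) : cosh t ^ 2 = 1 + sinh t ^ 2.
Proof.
assert (H := exp_plus t (- t)). rewrite Rplus_opp_r, exp_0 in H.
rewrite exp_opp_cosh_sinh, exp_cosh_sinh in H. lra.
Qed.

(** * Computation in explicit coordinates *)

Ltac unfold_components :=
  cbv beta iota zeta delta [pd upd crd cmp fst snd sum3 contract contract2 lie_bracket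
    two_form_of push_forward tan so13 gen_field gen_potential generator nth length dS3 mink
    chart11 chart12 chart13 chart14 chart21 chart22 chart23 chart31 chart32 chart33 chart34
    chart35 chart41].

(** The derivative is left as an existential variable, which [auto_derive] fills in; its side
    conditions, such as a nonzero cosine under a tangent, are sought among the hypotheses. *)
Ltac eval_derive :=
  repeat match goal with
  | |- context [Derive ?f ?t] =>
      let H := fresh in
      eassert (H : is_derive f t _) by (auto_derive; [repeat split; eauto .. | reflexivity]);
      rewrite (is_derive_unique _ _ _ H); clear H
  end.

Ltac smooth_expr :=
  lazymatch goal with
  | |- smooth _ (fun _ => ?c) => apply smooth_const
  | |- smooth _ (fun p => _ + _) => apply smooth_plus; [assumption | smooth_expr | smooth_expr]
  | |- smooth _ (fun p => _ - _) => apply smooth_minus; [assumption | smooth_expr | smooth_expr]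
  | |- smooth _ (fun p => _ * _) => apply smooth_mult; [assumption | smooth_expr | smooth_expr]
  | |- smooth _ (fun p => - _) => apply smooth_opp; [assumption | smooth_expr]
  | |- smooth _ (fun p => _ ^ _) => apply smooth_pow; [assumption | smooth_expr]
  | |- smooth _ (fun p => exp _) => apply smooth_exp; [assumption | smooth_expr]
  | |- smooth _ (fun p => sin _) => apply smooth_sin; [assumption | smooth_expr]
  | |- smooth _ (fun p => cos _) => apply smooth_cos; [assumption | smooth_expr]
  | |- smooth _ (fun p => sinh _) => apply smooth_sinh; [assumption | smooth_expr]
  | |- smooth _ (fun p => cosh _) => apply smooth_cosh; [assumption | smooth_expr]
  | |- smooth _ (fun p => _ / _) => apply smooth_mult; [assumption | smooth_expr | smooth_expr]
  | |- smooth _ (fun p => / _) =>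
      apply smooth_inv; [assumption | subst; intros [[? ?] ?] ?; simpl; eauto | smooth_expr]
  | |- _ => first [assumption | subst; assumption]
  end.

Ltac smooth_components :=
  apply smooth_coordinates; [assumption|];
  let g1 := fresh "g" in let g2 := fresh "g" in let g3 := fresh "g" in
  intros g1 g2 g3 ? ? ? ? ? ?; unfold_components; smooth_expr.

Ltac split_tuple :=
  repeat match goal with |- (_, _) = (_, _) => apply f_equal2 end.

(** * The coordinate systems on de Sitter space *)

Lemma smooth_map_chart11 (U : pt -> Prop) : open U -> smooth_map U chart11.
Proof. intros HU. repeat split; smooth_components. Qed.
Lemma smooth_map_chart12 (U : pt -> Prop) : open U -> smooth_map U chart12.
Proof. intros HU. repeat split; smooth_components. Qed.
Lemma smooth_map_chart13 (U : pt -> Prop) (a : R) : open U -> smooth_map U (chart13 a).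
Proof. intros HU. repeat split; smooth_components. Qed.
Lemma smooth_map_chart14 (U : pt -> Prop) : open U -> smooth_map U chart14.
Proof. intros HU. repeat split; smooth_components. Qed.
Lemma smooth_map_chart21 (U : pt -> Prop) : open U -> smooth_map U chart21.
Proof. intros HU. repeat split; smooth_components. Qed.
Lemma smooth_map_chart22 (U : pt -> Prop) : open U -> smooth_map U chart22.
Proof. intros HU. repeat split; smooth_components. Qed.
Lemma smooth_map_chart23 (U : pt -> Prop) : open U -> smooth_map U chart23.
Proof. intros HU. repeat split; smooth_components. Qed.
Lemma smooth_map_chart31 (U : pt -> Prop) : open U -> smooth_map U chart31.
Proof. intros HU. repeat split; smooth_components. Qed.
Lemma smooth_map_chart33 (U : pt -> Prop) (a : R) : open U -> smooth_map U (chart33 a).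
Proof. intros HU. repeat split; smooth_components. Qed.
Lemma smooth_map_chart34 (U : pt -> Prop) : open U -> smooth_map U chart34.
Proof. intros HU. repeat split; smooth_components. Qed.
Lemma smooth_map_chart35 (U : pt -> Prop) : open U -> smooth_map U chart35.
Proof. intros HU. repeat split; smooth_components. Qed.

Lemma dS3_chart11 (p : pt) : dS3 (chart11 p).
Proof.
destruct p as [[q1 q2] q3]; unfold_components.
ring [(sin_sq q2) (sin_sq q3) (cosh_sq q1)].
Qed.
Lemma dS3_chart12 (p : pt) : dS3 (chart12 p).
Proof.
destruct p as [[q1 q2] q3]; unfold_components.
ring [(sin_sq q1) (sin_sq q3) (cosh_sq q2)].
Qed.
Lemma dS3_chart13 (a : R) (p : pt) : dS3 (chart13 a p).
Proof.
destruct p as [[q1 q2] q3]; unfold_components.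
ring [(sin_sq q1) (sin_sq q3) (cosh_sq q2) (cosh_sq (a * q1))].
Qed.
Lemma dS3_chart14 (p : pt) : dS3 (chart14 p).
Proof.
destruct p as [[q1 q2] q3]; unfold_components.
field [(sin_sq q1) (sin_sq q3) (cosh_sq q2)].
Qed.
Lemma dS3_chart21 (p : pt) : dS3 (chart21 p).
Proof.
destruct p as [[q1 q2] q3]; unfold_components. rewrite exp_opp_cosh_sinh.
field [(cosh_sq q3)].
Qed.
Lemma dS3_chart22 (p : pt) : dS3 (chart22 p).
Proof.
destruct p as [[q1 q2] q3]; unfold_components.
ring [(sin_sq q1) (sin_sq q3) (cosh_sq q2)].
Qed.
Lemma dS3_chart23 (p : pt) : dS3 (chart23 p).
Proof.
destruct p as [[q1 q2] q3]; unfold_components. rewrite exp_cosh_sinh.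
field [(sin_sq q3) (cosh_sq q2)].
Qed.
Lemma dS3_chart31 (p : pt) : dS3 (chart31 p).
Proof.
destruct p as [[q1 q2] q3]; unfold_components. rewrite exp_cosh_sinh.
field [(cosh_sq q3)].
Qed.
Lemma dS3_chart33 (a : R) (p : pt) : dS3 (chart33 a p).
Proof. destruct p as [[q1 q2] q3]. apply dS3_chart31. Qed.
Lemma dS3_chart34 (p : pt) : dS3 (chart34 p).
Proof.
destruct p as [[q1 q2] q3]; unfold_components.
ring [(sin_sq q1) (sin_sq q2) (cosh_sq q3)].
Qed.
Lemma dS3_chart35 (p : pt) : dS3 (chart35 p).
Proof.
destruct p as [[q1 q2] q3]; unfold_components.
ring [(sin_sq q2) (sin_sq q3) (cosh_sq q1)].
Qed.

Ltac close_equation q1 q2 q3 :=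
  rewrite ?exp_opp_cosh_sinh, ?exp_cosh_sinh;
  first
    [ ring
    | field; solve [eauto | nra]
    | field [(sin_sq q1) (sin_sq q2) (sin_sq q3) (cosh_sq q1) (cosh_sq q2) (cosh_sq q3)];
      solve [eauto] ].

Ltac evaluate :=
  lazymatch goal with
  | _ : _ (?q1, ?q2, ?q3) |- _ => unfold_components; eval_derive; close_equation q1 q2 q3
  end.

(** The arguments are the boost and rotation parameters of the constant L in so(1,3) with X(x) = L
    x; they are read off from the derivatives of the chart. *)
Ltac killing_tac b1 b2 b3 r1 r2 r3 :=
  eapply (killing_of_so13 _ _ _ b1 b2 b3 r1 r2 r3);
  [ assumption
  | eauto using smooth_map_chart11, smooth_map_chart12, smooth_map_chart13, smooth_map_chart14,
      smooth_map_chart21, smooth_map_chart22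
  | intros []; smooth_components
  | intros [[q1 q2] q3] Hp; unfold_components; split_tuple; evaluate ].

(** For potentials built from unspecified functions: [D1] and [D2] supply their differentiability,
    and the value given by [D2] replaces the symbolic derivative. *)
Ltac antiderivative_tac D1 D2 :=
  let E1 := fresh in let E2 := fresh in
  assert (E1 := D1); assert (E2 := D2); unfold_components; cbv [crd snd] in E1, E2;
  apply is_derive_unique; auto_derive;
  [ repeat split; eexists; eassumption
  | repeat match goal with
    | |- context [Derive (fun x => ?h x) ?t] =>
        progress change (Derive (fun x => h x) t) with (Derive h t)
    end;
    try rewrite (is_derive_unique _ _ _ E2); ring ].

Lemma smooth_third_coordinate (U : pt -> Prop) (f : R -> R) : open U ->
  smooth U (fun '(q1, q2, u1) => f u1) -> smooth U (fun p => f (crd c3 p)).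
Proof.
intros HU Hf. apply smooth_ext with (3 := Hf); trivial. now intros [[q1 q2] q3].
Qed.

Ltac generator_tac b1 b2 b3 r1 r2 r3 :=
  split; [intros []; smooth_components|];
  split; [smooth_components|];
  split; [killing_tac b1 b2 b3 r1 r2 r3 | intros [] [[q1 q2] q3] Hp; evaluate].

Ltac represents_tac :=
  lazymatch goal with
  | |- represents _ _ op_zero _ _ => apply represents_zero
  | |- represents _ _ (op_add _ _) _ _ => apply represents_add; represents_tac
  | |- represents _ _ (op_scal _ _) _ _ => apply represents_scal; represents_tac
  | |- _ => apply represents_basis
  end.

Ltac relation_cases Hin :=
  lazymatch type of Hin with
  | False => contradiction
  | _ \/ _ => destruct Hin as [Hin|Hin]; relation_cases Hin
  | _ = _ => injection Hin as <- <- <-; eexists; eexists; split;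
     [represents_tac
     | intros [[q1 q2] q3] Hp; split; [intros []|]; evaluate]
  end.

Ltac relations_tac := intros A j k Z Hin; simpl in Hin; relation_cases Hin.

Ltac no_relations_tac :=
  intros X j k ? ? Hk; simpl in Hk; simpl;
  destruct j as [|[|[|[|[|?]]]]]; try lia; destruct k as [|[|[|[|[|?]]]]]; try lia; try tauto.

Lemma sum_n_S_R (f : nat -> R) (n : nat) : sum_n f (S n) = sum_n f n + f (S n).
Proof. apply (sum_Sn f n). Qed.

Ltac component_of H a Hp :=
  generalize (H a _ Hp); simpl length; rewrite ?sum_n_S_R, sum_O; unfold_components.

Ltac conclude_indep :=
  intros [|[|[|[|[|]]]]] Hj; simpl in Hj; first [lia | assumption | lra].

(** The tangent vector in the direction q^1 has the factor cos q^2. Where this vanishes, so does a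
    row of the metric, against nondegeneracy; hence tan q^2 is regular on every chart domain. *)
Lemma chart34_cos (U : pt -> Prop) : local_chart U chart34 ->
  forall q1 q2 q3, U (q1, q2, q3) -> cos q2 <> 0.
Proof.
intros [_ [_ [_ H]]] q1 q2 q3 Hp H0. apply (H _ Hp).
assert (Hm : forall b, metric chart34 c1 b (q1, q2, q3) = 0).
{ intros b.
  assert (Ht : tangent chart34 c1 (q1, q2, q3) = (0, 0, 0, 0)).
  { unfold tangent. unfold_components. split_tuple; eval_derive; rewrite ?H0; ring. }
  unfold metric, mink. rewrite Ht.
  destruct (tangent chart34 b (q1, q2, q3)) as [[[v1 v2] v3] v0]. ring. }
unfold gdet, det3, sum3. rewrite !Hm. ring.
Qed.

Lemma chart35_cos (U : pt -> Prop) : local_chart U chart35 ->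
  forall q1 q2 q3, U (q1, q2, q3) -> cos q2 <> 0.
Proof.
intros [_ [_ [_ H]]] q1 q2 q3 Hp H0. apply (H _ Hp).
assert (Hm : forall b, metric chart35 c1 b (q1, q2, q3) = 0).
{ intros b.
  assert (Ht : tangent chart35 c1 (q1, q2, q3) = (0, 0, 0, 0)).
  { unfold tangent. unfold_components. split_tuple; eval_derive; rewrite ?H0; ring. }
  unfold metric, mink. rewrite Ht.
  destruct (tangent chart35 b (q1, q2, q3)) as [[[v1 v2] v3] v0]. ring. }
unfold gdet, det3, sum3. rewrite !Hm. ring.
Qed.

(** * The nine families of subalgebras *)

Theorem mainTheorem3 (m e zeta : R) (Hm : 0 < m) (He : e <> 0)
    (Hzeta : zeta = 0 \/ zeta = (3 - 1) / (4 * 3)) :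
  (* 1 *)
  (forall (a : R) (x : pt -> R13) (U : pt -> Prop) (f1 f2 : R -> R -> R),
     0 < a -> In x [chart11; chart12; chart13 a; chart14] -> local_chart U x ->
     smooth U (fun '(q1, u1, u2) => f1 u1 u2) ->
     smooth U (fun '(q1, u1, u2) => f2 u1 u2) ->
     admits_symmetry_algebra U x zeta m e
       (fun i j p =>
          wedge (dx c1) (dfun (fun '(q1, u1, u2) => f1 u1 u2)) i j p
          + f2 (crd c2 p) (crd c3 p) * wedge (dx c2) (dx c3) i j p)
       [ ((fun _ => (1, 0, 0)), (fun '(q1, u1, u2) => - f1 u1 u2)) ]
       (fun X => []))
  /\
  (* 2; with the chi_A that solve d chi_A = - F(X_A, _) *)
  (forall (x : pt -> R13) (U : pt -> Prop) (mu : R) (f1 f2 If1 If2 : R -> R),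
     In x [chart21; chart22] -> local_chart U x ->
     smooth U (fun '(q1, q2, u1) => f1 u1) ->
     smooth U (fun '(q1, q2, u1) => f2 u1) ->
     antiderivative_on U c3 If1 f1 ->
     antiderivative_on U c3 If2 f2 ->
     admits_symmetry_algebra U x zeta m e
       (fun i j p =>
          mu * wedge (dx c1) (dx c2) i j p
          + f1 (crd c3 p) * wedge (dx c1) (dx c3) i j p
          + f2 (crd c3 p) * wedge (dx c2) (dx c3) i j p)
       [ ((fun _ => (1, 0, 0)), (fun '(q1, q2, u1) => - (mu * q2 + If1 u1)));
         ((fun _ => (0, 1, 0)), (fun '(q1, q2, u1) => mu * q1 - If2 u1)) ]
       (fun X => [ (1%nat, 2%nat, op_scal mu (X 0%nat)) ]))
  /\
  (* 3; with the chi_A that solve d chi_A = - F(X_A, _) *)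
  (forall (U : pt -> Prop) (f1 f2 If2 : R -> R),
     local_chart U chart23 ->
     smooth U (fun '(q1, q2, u1) => f1 u1) ->
     smooth U (fun '(q1, q2, u1) => f2 u1) ->
     antiderivative_on U c3 If2 f2 ->
     admits_symmetry_algebra U chart23 zeta m e
       (fun i j p =>
          exp (crd c2 p)
          * wedge (dx c1)
              (fun k q => f1 (crd c3 q) * dx c2 k q
                          + dfun (fun '(q1, q2, u1) => f1 u1) k q) i j p
          + f2 (crd c3 p) * wedge (dx c2) (dx c3) i j p)
       [ ((fun _ => (1, 0, 0)), (fun '(q1, q2, u1) => - (exp q2 * f1 u1)));
         ((fun '(q1, q2, u1) => (- q1, 1, 0)),
          (fun '(q1, q2, u1) => q1 * exp q2 * f1 u1 - If2 u1)) ]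
       (fun X => [ (1%nat, 2%nat, op_scal (-1) (X 1%nat)) ]))
  /\
  (* 4 *)
  (forall (U : pt -> Prop) (mu1 mu2 : R),
     local_chart U chart31 ->
     admits_symmetry_algebra U chart31 zeta m e
       (fun i j p =>
          exp (crd c3 p)
          * wedge (fun k q => mu1 * dx c1 k q + mu2 * dx c2 k q) (dx c3) i j p)
       [ ((fun _ => (1, 0, 0)), (fun '(q1, q2, q3) => - (mu1 * exp q3)));
         ((fun _ => (0, 1, 0)), (fun '(q1, q2, q3) => - (mu2 * exp q3)));
         ((fun '(q1, q2, q3) => (- q1, - q2, 1)),
          (fun '(q1, q2, q3) => exp q3 * (mu1 * q1 + mu2 * q2))) ]
       (fun X => [ (1%nat, 2%nat, op_zero);
                   (1%nat, 3%nat, op_scal (-1) (X 1%nat));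
                   (2%nat, 3%nat, op_scal (-1) (X 2%nat)) ]))
  /\
  (* 5 *)
  (forall (U : pt -> Prop) (mu : R),
     local_chart U chart32 ->
     admits_symmetry_algebra U chart32 zeta m e
       (fun i j p => mu * wedge (dx c1) (dx c2) i j p)
       [ ((fun _ => (1, 0, 0)), (fun '(q1, q2, u1) => - (mu * q2)));
         ((fun _ => (0, 1, 0)), (fun '(q1, q2, u1) => mu * q1));
         ((fun '(q1, q2, u1) => (- q2, q1, 0)),
          (fun '(q1, q2, u1) => / 2 * mu * (q1 ^ 2 + q2 ^ 2))) ]
       (fun X => [ (1%nat, 2%nat, op_scal mu (X 0%nat));
                   (1%nat, 3%nat, X 2%nat);
                   (2%nat, 3%nat, op_scal (-1) (X 1%nat)) ]))
  /\
  (* 6 *)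
  (forall (a : R) (U : pt -> Prop) (mu1 mu2 : R),
     0 < a -> local_chart U (chart33 a) ->
     admits_symmetry_algebra U (chart33 a) zeta m e
       (fun i j p =>
          let q3 := crd c3 p in
          exp (a * q3) * (mu1 * cos q3 + mu2 * sin q3) * wedge (dx c1) (dx c3) i j p
          + exp (a * q3) * (mu1 * sin q3 - mu2 * cos q3) * wedge (dx c2) (dx c3) i j p)
       [ ((fun _ => (1, 0, 0)),
          (fun '(q1, q2, q3) =>
             exp (a * q3) * ((mu2 - a * mu1) / (1 + a ^ 2) * cos q3
                             - (mu1 + a * mu2) / (1 + a ^ 2) * sin q3)));
         ((fun _ => (0, 1, 0)),
          (fun '(q1, q2, q3) =>
             exp (a * q3) * ((mu2 - a * mu1) / (1 + a ^ 2) * sin q3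
                             + (mu1 + a * mu2) / (1 + a ^ 2) * cos q3)));
         ((fun '(q1, q2, q3) => (- (a * q1 + q2), q1 - a * q2, 1)),
          (fun '(q1, q2, q3) =>
             exp (a * q3) * (mu1 * q1 - mu2 * q2) * cos q3
             + exp (a * q3) * (mu1 * q2 + mu2 * q1) * sin q3)) ]
       (fun X => [ (1%nat, 2%nat, op_zero);
                   (1%nat, 3%nat, op_add (X 2%nat) (op_scal (- a) (X 1%nat)));
                   (2%nat, 3%nat,
                    op_add (op_scal (-1) (X 1%nat)) (op_scal (- a) (X 2%nat))) ]))
  /\
  (* 7 *)
  (forall (U : pt -> Prop) (mu : R),
     local_chart U chart34 ->
     admits_symmetry_algebra U chart34 zeta m e
       (fun i j p => mu * cos (crd c2 p) * wedge (dx c1) (dx c2) i j p)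
       [ ((fun _ => (1, 0, 0)), (fun '(q1, q2, u1) => - (mu * sin q2)));
         ((fun '(q1, q2, u1) => (sin q1 * tan q2, cos q1, 0)),
          (fun '(q1, q2, u1) => mu * sin q1 * cos q2));
         ((fun '(q1, q2, u1) => (cos q1 * tan q2, - sin q1, 0)),
          (fun '(q1, q2, u1) => mu * cos q1 * cos q2)) ]
       (fun X => [ (1%nat, 2%nat, X 3%nat);
                   (2%nat, 3%nat, X 1%nat);
                   (3%nat, 1%nat, X 2%nat) ]))
  /\
  (* 8 *)
  (forall (U : pt -> Prop) (mu : R),
     local_chart U chart35 ->
     admits_symmetry_algebra U chart35 zeta m e
       (fun i j p => mu * cos (crd c2 p) * wedge (dx c1) (dx c2) i j p)
       [ ((fun _ => (1, 0, 0)), (fun '(q1, q2, u1) => - (mu * sin q2)));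
         ((fun '(q1, q2, u1) => (sinh q1 * tan q2, cosh q1, 0)),
          (fun '(q1, q2, u1) => mu * sinh q1 * cos q2));
         ((fun '(q1, q2, u1) => (cosh q1 * tan q2, sinh q1, 0)),
          (fun '(q1, q2, u1) => mu * cosh q1 * cos q2)) ]
       (fun X => [ (1%nat, 2%nat, X 3%nat);
                   (1%nat, 3%nat, X 2%nat);
                   (2%nat, 3%nat, X 1%nat) ]))
  /\
  (* 9 *)
  (forall (U : pt -> Prop),
     local_chart U chart41 ->
     admits_symmetry_algebra U chart41 zeta m e
       (fun i j p => 0)
       [ ((fun _ => (1, 0, 0)), (fun _ => 0));
         ((fun _ => (0, 1, 0)), (fun _ => 0));
         ((fun '(q1, q2, q3) => (- q2, q1, 0)), (fun _ => 0));
         ((fun '(q1, q2, q3) => (- q1, - q2, 1)), (fun _ => 0)) ]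
       (fun X => [ (1%nat, 2%nat, op_zero);
                   (1%nat, 3%nat, X 2%nat);
                   (1%nat, 4%nat, op_scal (-1) (X 1%nat));
                   (2%nat, 3%nat, op_scal (-1) (X 1%nat));
                   (2%nat, 4%nat, op_scal (-1) (X 2%nat)) ])).
Proof.
repeat apply conj.
- intros a x U f1 f2 Ha Hin Hch S1 S2. destruct (Hch) as [HU [[[[r1 r2] r3] Hp0] _]].
  set (f := (fun '(q1, u1, u2) => f1 u1 u2) : pt -> R) in *.
  assert (Hx : smooth_map U x /\ (forall p, dS3 (x p)) /\
    invariant2 U (fun _ => (1, 0, 0)) (metric x)).
  { simpl in Hin. destruct Hin as [<-|[<-|[<-|[<-|[]]]]]; (split; [|split]);
      auto using smooth_map_chart11, smooth_map_chart12, smooth_map_chart13, smooth_map_chart14,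
        dS3_chart11, dS3_chart12, dS3_chart13, dS3_chart14.
    (* In order: a boost along x^3, a rotation of the plane x^1 x^2, that rotation combined with a
       boost of rate [a], and a null rotation. *)
    - killing_tac 0 0 (-1) 0 0 0.
    - killing_tac 0 0 0 0 0 1.
    - killing_tac 0 0 (-a) 0 0 1.
    - killing_tac (-1) 0 0 0 1 0. }
  destruct Hx as [Hx [HdS HK]].
  assert (Hf : forall p, pd c1 f p = 0).
  { intros [[q1 q2] q3]. apply (Derive_const (f1 q2 q3)). }
  assert (S2' : smooth U (fun p => f2 (crd c2 p) (crd c3 p))).
  { apply smooth_ext with (3 := S2); trivial; now intros [[q1 q2] q3]. }
  (* The first two components of F are the partial derivatives of one function independent of q^1,
     so closedness is the symmetry of its second derivatives. *)
  apply (symmetry_algebra_of_generators U x zeta m e _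
    (pd c2 f) (pd c3 f) (fun p => f2 (crd c2 p) (crd c3 p))); trivial; auto using smooth_pd.
  + intros a' b' p. unfold wedge, dx, dfun. rewrite !pd_crd.
    destruct a', b'; simpl; rewrite ?Hf; ring.
  + intros p Hp. rewrite (pd_comm U f c2 c3) by trivial.
    replace (pd c1 _ p) with 0; [ring|]. destruct p as [[q1 q2] q3].
    symmetry; apply (Derive_const (f2 q2 q3)).
  + assert (Hchi : (fun '(q1, u1, u2) => - f1 u1 u2) = (fun p => - f p))
      by (apply functional_extensionality; now intros [[q1 q2] q3]).
    intros g [<-|[]]. rewrite Hchi. split; [intros []; smooth_components|].
    split; [now apply smooth_opp|]. split; [exact HK|].
    intros b p Hp. simpl. rewrite pd_opp. unfold contract, sum3, cmp, two_form_of.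
    destruct b; simpl; rewrite ?Hf; ring.
  + intros c H.
    component_of H c1 Hp0. intros E1. conclude_indep.
  + intros A j k Z [].
  + no_relations_tac.
- intros x U mu f1 f2 If1 If2 Hin Hch S1 S2 H1 H2.
  destruct (Hch) as [HU [[[[r1 r2] r3] Hp0] _]].
  assert (Hx : smooth_map U x /\ (forall p, dS3 (x p)) /\
    invariant2 U (fun _ => (1, 0, 0)) (metric x) /\
    invariant2 U (fun _ => (0, 1, 0)) (metric x)).
  { simpl in Hin. destruct Hin as [<-|[<-|[]]]; (split; [|split; [|split]]);
      auto using smooth_map_chart21, smooth_map_chart22, dS3_chart21, dS3_chart22.
    (* In the first chart the fields are two commuting null rotations preserving x^3 - x^0; in the
       second, a rotation and a boost in complementary planes. *)
    - killing_tac (-1) 0 0 0 1 0.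
    - killing_tac 0 (-1) 0 (-1) 0 0.
    - killing_tac 0 0 0 0 0 1.
    - killing_tac 0 0 (-1) 0 0 0. }
  destruct Hx as [Hx [HdS [HK1 HK2]]]. clear Hin.
  apply smooth_third_coordinate in S1; trivial. apply smooth_third_coordinate in S2; trivial.
  assert (SI1 := smooth_antiderivative U c3 If1 f1 HU H1 S1).
  assert (SI2 := smooth_antiderivative U c3 If2 f2 HU H2 S2).
  apply (symmetry_algebra_of_generators U x zeta m e _
    (fun _ => mu) (fun p => f1 (crd c3 p)) (fun p => f2 (crd c3 p))); trivial.
  + intros a b p. unfold wedge, dx, dfun. rewrite !pd_crd. destruct a, b; simpl; ring.
  + apply smooth_const.
  + intros [[q1 q2] q3] Hp. evaluate.
  + intros g [<-|[<-|[]]].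
    * split; [intros []; smooth_components|]. split; [smooth_components|].
      split; [exact HK1|].
      intros [] [[q1 q2] q3] Hp; [evaluate | evaluate |].
      antiderivative_tac (H1 _ Hp) (H1 _ Hp).
    * split; [intros []; smooth_components|]. split; [smooth_components|].
      split; [exact HK2|].
      intros [] [[q1 q2] q3] Hp; [evaluate | evaluate |].
      antiderivative_tac (H2 _ Hp) (H2 _ Hp).
  + intros c H.
    component_of H c1 Hp0. component_of H c2 Hp0. intros E2 E1. conclude_indep.
  + relations_tac.
  + no_relations_tac.
- intros U f1 f2 If2 Hch S1 S2 H2.
  destruct (Hch) as [HU [[[[r1 r2] r3] Hp0] _]].
  assert (Hx := smooth_map_chart23 U HU).
  (* The differential of [f1] enters F, so its derivative has to be a genuine smooth component; both
     facts come from smoothness of [f1] as a function on [U]. *)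
  assert (Df1 : forall p, U p -> is_derive f1 (crd c3 p) (Derive f1 (crd c3 p))).
  { intros [[q1 q2] q3] Hp. apply Derive_correct. exact (smooth_has_pd U _ c3 _ S1 Hp). }
  assert (S1' : smooth U (fun p => Derive f1 (crd c3 p))).
  { apply smooth_ext with (3 := smooth_pd U c3 _ S1); trivial; now intros [[q1 q2] q3]. }
  apply smooth_third_coordinate in S1; trivial. apply smooth_third_coordinate in S2; trivial.
  assert (SI2 := smooth_antiderivative U c3 If2 f2 HU H2 S2).
  apply (symmetry_algebra_of_generators U chart23 zeta m e _
    (fun p => exp (crd c2 p) * f1 (crd c3 p)) (fun p => exp (crd c2 p) * Derive f1 (crd c3 p))
    (fun p => f2 (crd c3 p))); trivial; try smooth_components.
  + intros; apply dS3_chart23.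
  + intros a b [[q1 q2] q3]. unfold wedge, dx, dfun. rewrite !pd_crd.
    assert (E3 : pd c3 (fun '(q1, q2, u1) => f1 u1) (q1, q2, q3) = Derive f1 q3) by reflexivity.
    assert (E : forall c, c <> c3 -> pd c (fun '(q1, q2, u1) => f1 u1) (q1, q2, q3) = 0)
      by (intros [] Hc; [apply (Derive_const (f1 q3)) | apply (Derive_const (f1 q3)) | easy]).
    destruct a, b; simpl; rewrite ?E3, ?E by easy; ring.
  + intros [[q1 q2] q3] Hp. unfold_components. rewrite Derive_const, Derive_scal, Derive_scal_l.
    rewrite (is_derive_unique _ _ _ (is_derive_exp q2)). ring.
  + intros g [<-|[<-|[]]].
    * split; [intros []; smooth_components|]. split; [smooth_components|].
      split; [killing_tac (-1) 0 0 0 1 0|].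
      intros [] [[q1 q2] q3] Hp; [evaluate | evaluate |].
      antiderivative_tac (Df1 _ Hp) (Df1 _ Hp).
    * split; [intros []; smooth_components|]. split; [smooth_components|].
      split; [killing_tac 0 0 (-1) 0 0 0|].
      intros [] [[q1 q2] q3] Hp; [evaluate | evaluate |].
      antiderivative_tac (Df1 _ Hp) (H2 _ Hp).
  + intros c H.
    component_of H c1 Hp0. component_of H c2 Hp0. intros E2 E1.
    (* Only X_2 has a component along q^2. *)
    assert (E : c 2%nat = 0) by lra. rewrite E in *. conclude_indep.
  + relations_tac.
  + no_relations_tac.
- intros U mu1 mu2 Hch. destruct (Hch) as [HU [[[[r1 r2] r3] Hp0] _]].
  assert (Hx := smooth_map_chart31 U HU).
  apply (symmetry_algebra_of_generators U chart31 zeta m e _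
    (fun _ => 0) (fun p => mu1 * exp (crd c3 p)) (fun p => mu2 * exp (crd c3 p))); trivial;
    try smooth_components.
  + intros; apply dS3_chart31.
  + intros a' b' p. unfold wedge, dx, dfun. rewrite !pd_crd. destruct a', b'; simpl; ring.
  + intros [[q1 q2] q3] Hp. evaluate.
  + intros g [<-|[<-|[<-|[]]]].
    * generator_tac (-1) 0 0 0 1 0.
    * generator_tac 0 (-1) 0 (-1) 0 0.
    * generator_tac 0 0 (-1) 0 0 0.
  + intros c H.
    component_of H c1 Hp0. component_of H c2 Hp0. component_of H c3 Hp0.
    intros E3 E2 E1.
    (* Only X_3 has a component along q^3. *)
    assert (E : c 3%nat = 0) by lra. rewrite E in *.
    conclude_indep.
  + relations_tac.
  + no_relations_tac.
- intros U mu Hch. destruct (Hch) as [HU [[[[r1 r2] r3] Hp0] _]].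
  assert (Hx := smooth_map_chart21 U HU).
  apply (symmetry_algebra_of_generators U chart32 zeta m e _
    (fun _ => mu) (fun _ => 0) (fun _ => 0)); trivial;
    try smooth_components.
  + intros; apply dS3_chart21.
  + intros a' b' p. unfold wedge, dx, dfun. rewrite !pd_crd. destruct a', b'; simpl; ring.
  + intros [[q1 q2] q3] Hp. evaluate.
  + intros g [<-|[<-|[<-|[]]]].
    * generator_tac (-1) 0 0 0 1 0.
    * generator_tac 0 (-1) 0 (-1) 0 0.
    * generator_tac 0 0 0 0 0 1.
  + intros c H.
    (* At one point the three fields are dependent, all being tangent to the q^1 q^2 surface; the
       relation is therefore differentiated in q^2 on the open set, which isolates the coefficient
       of the rotation. *)
    assert (E : forall p, U p -> c 1%nat - c 3%nat * crd c2 p = 0).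
    { intros [[q1 q2] q3] Hp. component_of H c1 Hp. lra. }
    assert (D := pd_zero_on U _ c2 _ HU E Hp0). revert D. unfold_components. eval_derive.
    component_of H c1 Hp0. component_of H c2 Hp0. component_of H c3 Hp0.
    intros E3 E2 E1 D.
    assert (D0 : c 3%nat = 0) by lra. rewrite D0 in *.
    conclude_indep.
  + relations_tac.
  + no_relations_tac.
- intros a U mu1 mu2 Ha Hch. destruct (Hch) as [HU [[[[r1 r2] r3] Hp0] _]].
  assert (Hx := smooth_map_chart33 U a HU).
  (* This denominator arises on integrating e^{a q} cos q and e^{a q} sin q to obtain the first two
     chi's. *)
  assert (Ha2 : 1 + a ^ 2 <> 0) by nra.
  apply (symmetry_algebra_of_generators U (chart33 a) zeta m e _
    (fun _ => 0)
    (fun p => exp (a * crd c3 p) * (mu1 * cos (crd c3 p) + mu2 * sin (crd c3 p)))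
    (fun p => exp (a * crd c3 p) * (mu1 * sin (crd c3 p) - mu2 * cos (crd c3 p)))); trivial;
    try smooth_components.
  + intros; apply dS3_chart33.
  + intros a' b' p. unfold wedge, dx, dfun. rewrite !pd_crd. destruct a', b'; simpl; ring.
  + intros [[q1 q2] q3] Hp. evaluate.
  + intros g [<-|[<-|[<-|[]]]].
    * generator_tac (-1) 0 0 0 1 0.
    * generator_tac 0 (-1) 0 (-1) 0 0.
    (* A rotation of the plane x^1 x^2 together with a boost of rate [a] along x^3. *)
    * generator_tac 0 0 (-a) 0 0 1.
  + intros c H.
    component_of H c1 Hp0. component_of H c2 Hp0. component_of H c3 Hp0.
    intros E3 E2 E1.
    assert (E : c 3%nat = 0) by lra. rewrite E in *.
    conclude_indep.
  + relations_tac.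
  + no_relations_tac.
- intros U mu Hch. destruct (Hch) as [HU [[[[r1 r2] r3] Hp0] _]].
  assert (Hx := smooth_map_chart34 U HU).
  assert (Hcos := chart34_cos U Hch).
  apply (symmetry_algebra_of_generators U chart34 zeta m e _
    (fun p => mu * cos (crd c2 p)) (fun _ => 0) (fun _ => 0)); trivial;
    try smooth_components.
  + intros; apply dS3_chart34.
  + intros a' b' p. unfold wedge, dx, dfun. rewrite !pd_crd. destruct a', b'; simpl; ring.
  + intros [[q1 q2] q3] Hp. evaluate.
  + intros g [<-|[<-|[<-|[]]]].
    (* The three fields are the rotations of the spheres on which x^0 = sinh u^1 is constant. *)
    * generator_tac 0 0 0 0 0 1.
    * generator_tac 0 0 0 1 0 0.
    * generator_tac 0 0 0 0 (-1) 0.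
  + intros c H.
    assert (E : forall p, U p -> c 2%nat * cos (crd c1 p) - c 3%nat * sin (crd c1 p) = 0).
    { intros [[q1 q2] q3] Hp. component_of H c2 Hp. lra. }
    assert (D := pd_zero_on U _ c1 _ HU E Hp0). generalize (E _ Hp0).
    revert D. unfold_components. eval_derive. component_of H c1 Hp0. intros E1 D E2.

    (* Up to a sign in [D], the relation and its derivative in q^1 are a rotation by [r1] applied to
       the pair of coefficients; the inverse rotation shows that both coefficients vanish. *)
    assert (C2 : c 2%nat = 0).
    { transitivity (cos r1 * (c 2%nat * cos r1 - c 3%nat * sin r1)
        - sin r1 * (c 2%nat * (1 * - sin r1) + - (c 3%nat * (1 * cos r1))));
        [ring [(sin_sq r1)] | rewrite E2, D; ring]. }
    assert (C3 : c 3%nat = 0).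
    { transitivity (- sin r1 * (c 2%nat * cos r1 - c 3%nat * sin r1)
        - cos r1 * (c 2%nat * (1 * - sin r1) + - (c 3%nat * (1 * cos r1))));
        [ring [(sin_sq r1)] | rewrite E2, D; ring]. }
    rewrite C2, C3 in E1.
    conclude_indep.
  + relations_tac.
  + no_relations_tac.
- intros U mu Hch. destruct (Hch) as [HU [[[[r1 r2] r3] Hp0] _]].
  assert (Hx := smooth_map_chart35 U HU).
  assert (Hcos := chart35_cos U Hch).
  apply (symmetry_algebra_of_generators U chart35 zeta m e _
    (fun p => mu * cos (crd c2 p)) (fun _ => 0) (fun _ => 0)); trivial;
    try smooth_components.
  + intros; apply dS3_chart35.
  + intros a' b' p. unfold wedge, dx, dfun. rewrite !pd_crd. destruct a', b'; simpl; ring.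
  + intros [[q1 q2] q3] Hp. evaluate.
  + intros g [<-|[<-|[<-|[]]]].
    (* A boost along x^1, a rotation of the plane x^1 x^2 and a boost along x^2: the algebra so(1,2)
       fixing x^3 = cos u^1. *)
    * generator_tac (-1) 0 0 0 0 0.
    * generator_tac 0 0 0 0 0 1.
    * generator_tac 0 (-1) 0 0 0 0.
  + intros c H.
    assert (E : forall p, U p -> c 2%nat * cosh (crd c1 p) + c 3%nat * sinh (crd c1 p) = 0).
    { intros [[q1 q2] q3] Hp. component_of H c2 Hp. lra. }
    assert (D := pd_zero_on U _ c1 _ HU E Hp0). generalize (E _ Hp0).
    revert D. unfold_components. eval_derive. component_of H c1 Hp0. intros E1 D E2.

    (* Here the relation and its derivative form a hyperbolic rotation of the two coefficients,
       inverted by means of [cosh_sq]. *)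
    assert (C2 : c 2%nat = 0).
    { transitivity (cosh r1 * (c 2%nat * cosh r1 + c 3%nat * sinh r1)
        - sinh r1 * (c 2%nat * (1 * sinh r1) + c 3%nat * (1 * cosh r1)));
        [ring [(cosh_sq r1)] | rewrite E2, D; ring]. }
    assert (C3 : c 3%nat = 0).
    { transitivity (- sinh r1 * (c 2%nat * cosh r1 + c 3%nat * sinh r1)
        + cosh r1 * (c 2%nat * (1 * sinh r1) + c 3%nat * (1 * cosh r1)));
        [ring [(cosh_sq r1)] | rewrite E2, D; ring]. }
    rewrite C2, C3 in E1.
    conclude_indep.
  + relations_tac.
  + no_relations_tac.
- intros U Hch. destruct (Hch) as [HU [[[[r1 r2] r3] Hp0] _]].
  assert (Hx := smooth_map_chart31 U HU).
  apply (symmetry_algebra_of_generators U chart41 zeta m e _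
    (fun _ => 0) (fun _ => 0) (fun _ => 0)); trivial;
    try smooth_components.
  + intros; apply dS3_chart31.
  + intros [] [] p; simpl; ring.
  + intros [[q1 q2] q3] Hp. evaluate.
  + intros g [<-|[<-|[<-|[<-|[]]]]].
    * generator_tac (-1) 0 0 0 1 0.
    * generator_tac 0 (-1) 0 (-1) 0 0.
    * generator_tac 0 0 0 0 0 1.
    * generator_tac 0 0 (-1) 0 0 0.
  + intros c H.
    assert (E4 : c 4%nat = 0) by (component_of H c3 Hp0; lra).
    assert (E : forall p, U p -> c 1%nat - c 3%nat * crd c2 p = 0).
    { intros [[q1 q2] q3] Hp. component_of H c1 Hp. rewrite E4. lra. }
    assert (D := pd_zero_on U _ c2 _ HU E Hp0). revert D. unfold_components. eval_derive.
    component_of H c1 Hp0. component_of H c2 Hp0. intros E2 E1 D.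
    assert (D0 : c 3%nat = 0) by lra. rewrite D0, E4 in *.
    conclude_indep.
  + relations_tac.
  + no_relations_tac.
    (* The one pair not listed is (3, 4): the rotation about the origin commutes with the
       dilation. *)
    intros _ _ [[q1 q2] q3] Hp. split; [intros []|]; evaluate.
Qed.
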